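(* Let $A$ and $B$ be rings, $M$ a $B$-$A$-bimodule, $N$ an $A$-$B$-bimodule, and let $\Lambda=\begin{pmatrix}A&N\\ M&B\end{pmatrix}$ be the Morita context ring with zero bimodule homomorphisms. Let $(\mathcal{U},\mathcal{X})$ and $(\mathcal{V},\mathcal{Y})$ be hereditary complete cotorsion pairs in $A\text{-}\mathrm{Mod}$ and $B\text{-}\mathrm{Mod}$, respectively. Assume that $\mathrm{Tor}_1^A(M,U)=0$ for all $U\in\mathcal{U}$ and $\mathrm{Tor}_1^B(N,V)=0$ for all $V\in\mathcal{V}$. If $M\otimes_A U\in\mathcal{Y}$ for all $U\in\mathcal{U}$ and $N\otimes_B V\in\mathcal{X}$ for all $V\in\mathcal{V}$, then the following hold. (1) $\big({}^{\perp}\left(\begin{smallmatrix}\mathcal{X}\\ \mathcal{Y}\end{smallmatrix}\right),\left(\begin{smallmatrix}\mathcal{X}\\ \mathcal{Y}\end{smallmatrix}\right)\big)$ is a hereditary complete cotorsion pair in $\Lambda\text{-}\mathrm{Mod}$. (2) If $M\otimes_A N=0=N\otimes_B M$, then $\big(\mathsf{T}_A(\mathcal{U})\oplus\mathsf{T}_B(\mathcal{V}),\left(\begin{smallmatrix}\mathcal{X}\\ \mathcal{Y}\end{smallmatrix}\right)\big)$ is a hereditary complete cotorsion pair in $\Lambda\text{-}\mathrm{Mod}$.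
   Context: All modules are left modules. $\Lambda$ has componentwise addition and multiplication $\begin{pmatrix}a_1&n_1\\ m_1&b_1\end{pmatrix}\begin{pmatrix}a_2&n_2\\ m_2&b_2\end{pmatrix}=\begin{pmatrix}a_1a_2&a_1n_2+n_1b_2\\ m_1a_2+b_1m_2&b_1b_2\end{pmatrix}$. The category $\Lambda\text{-}\mathrm{Mod}$ is identified with the category of tuples $\left(\begin{smallmatrix}X\\ Y\end{smallmatrix}\right)_{f,g}$ with $X\in A\text{-}\mathrm{Mod}$, $Y\in B\text{-}\mathrm{Mod}$, $f:N\otimes_B Y\to X$ an $A$-map and $g:M\otimes_A X\to Y$ a $B$-map such that $f\circ(1_N\otimes g)=0$ and $g\circ(1_M\otimes f)=0$; morphisms are pairs of maps compatible with $f$ and $g$. $\left(\begin{smallmatrix}\mathcal{X}\\ \mathcal{Y}\end{smallmatrix}\right)=\{\left(\begin{smallmatrix}X\\ Y\end{smallmatrix}\right)_{f,g}\in\Lambda\text{-}\mathrm{Mod} : X\in\mathcal{X},\,Y\in\mathcal{Y}\}$. $\mathsf{T}_A:A\text{-}\mathrm{Mod}\to\Lambda\text{-}\mathrm{Mod}$, $X\mapsto\left(\begin{smallmatrix}X\\ M\otimes_A X\end{smallmatrix}\right)_{0,1}$; $\mathsf{T}_B:B\text{-}\mathrm{Mod}\to\Lambda\text{-}\mathrm{Mod}$, $Y\mapsto\left(\begin{smallmatrix}N\otimes_B Y\\ Y\end{smallmatrix}\right)_{1,0}$. $\mathsf{T}_A(\mathcal{U})\oplus\mathsf{T}_B(\mathcal{V})$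 is the class of modules isomorphic to $\mathsf{T}_A(U)\oplus\mathsf{T}_B(V)$ with $U\in\mathcal{U}$, $V\in\mathcal{V}$. For a class $\mathcal{S}$ of objects in an abelian category: ${}^{\perp}\mathcal{S}=\{Y : \mathrm{Ext}^1(Y,S)=0\ \forall S\in\mathcal{S}\}$, $\mathcal{S}^{\perp}=\{Y : \mathrm{Ext}^1(S,Y)=0\ \forall S\in\mathcal{S}\}$. A pair $(\mathcal{C},\mathcal{D})$ is a cotorsion pair if $\mathcal{C}={}^{\perp}\mathcal{D}$ and $\mathcal{D}=\mathcal{C}^{\perp}$; it is complete if for every object $Z$ there are exact sequences $0\to D\to C\to Z\to0$ and $0\to Z\to D'\to C'\to0$ with $C,C'\in\mathcal{C}$, $D,D'\in\mathcal{D}$; it is hereditary if $\mathrm{Ext}^i(C,D)=0$ for all $i\ge1$, $C\in\mathcal{C}$, $D\in\mathcal{D}$. *)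

(* Defs.v *)
From HB Require Import structures.
From mathcomp Require Import all_boot all_algebra.
From mathcomp Require Import boolp.

Set Implicit Arguments.
Unset Strict Implicit.
Unset Printing Implicit Defensive.

Import GRing.Theory.
Local Open Scope ring_scope.
Local Open Scope quotient_scope.

(* Rings are [pzRingType]s (associative, unital, possibly zero, not assumed   *)
(* commutative); [lmodType R] is the type of left [R]-modules.                *)

(* Elements are finite formal sums of generators (lists), taken modulo the    *)
(* congruence generated by the relations.  This is a priori the presented     *)
(* commutative monoid; [pres_negP] says that every generator has an inverse   *)
(* there, so that it is also the abelian group with the same presentation     *)
(* (see [pres_lift_pgen] and [pres_ext] for the universal property).          *)

Inductive pres_cong (T : Type) (e : seq T -> seq T -> Prop) :
    seq T -> seq T -> Prop :=
  | pres_cong_rel s t : e s t -> pres_cong e s t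
  | pres_cong_refl s : pres_cong e s s
  | pres_cong_sym s t : pres_cong e s t -> pres_cong e t s
  | pres_cong_trans t s u :
      pres_cong e s t -> pres_cong e t u -> pres_cong e s u
  | pres_cong_cat s s' t t' : pres_cong e s s' -> pres_cong e t t' ->
      pres_cong e (s ++ t) (s' ++ t')
  | pres_cong_comm s t : pres_cong e (s ++ t) (t ++ s).

Record presentation := Presentation {
  pres_gen : choiceType;
  pres_rel : seq pres_gen -> seq pres_gen -> Prop;
  pres_neg : pres_gen -> pres_gen;
  pres_negP : forall x, pres_cong pres_rel [:: pres_neg x; x] [::]
}.

Section Presented.
Variable P : presentation.
Implicit Types (s t : seq (pres_gen P)).

Definition pres_eqv : rel (seq (pres_gen P)) :=
  fun s t => `[< pres_cong (@pres_rel P) s t >].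

Lemma pres_eqv_equiv : equiv_class_of pres_eqv.
Proof.
split=> [s|s t|t s u].
- exact/asboolP/pres_cong_refl.
- by apply/asboolP/asboolP; apply: pres_cong_sym.
- by move=> /asboolP st /asboolP tu; apply/asboolP/(pres_cong_trans st).
Qed.

Canonical pres_eqv_rel := EquivRelPack pres_eqv_equiv.

Definition presented : Type := {eq_quot pres_eqv}.

HB.instance Definition _ := Choice.on presented.
HB.instance Definition _ : EqQuotient (seq (pres_gen P)) pres_eqv presented :=
  EqQuotient.on presented.

Lemma pres_eqP s t :
  (\pi_presented s = \pi_presented t) <-> pres_cong (@pres_rel P) s t.
Proof. by split=> [/eqmodP/asboolP|st] //; apply/eqmodP/asboolP. Qed.

Definition pres_add (p q : presented) : presented :=
  \pi_presented (repr p ++ repr q).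
Definition pres_zero : presented := \pi_presented [::].
Definition pres_opp (p : presented) : presented :=
  \pi_presented (map (@pres_neg P) (repr p)).

Lemma pres_addE s t :
  pres_add (\pi_presented s) (\pi_presented t) = \pi_presented (s ++ t).
Proof. by apply/pres_eqP/pres_cong_cat; apply/pres_eqP; rewrite reprK. Qed.

Lemma pres_addA : associative pres_add.
Proof.
elim/quotW=> s; elim/quotW=> t; elim/quotW=> u.
by rewrite (pres_addE t) (pres_addE s t) (pres_addE s) (pres_addE _ u) catA.
Qed.

Lemma pres_addC : commutative pres_add.
Proof. by move=> p q; apply/pres_eqP/pres_cong_comm. Qed.

Lemma pres_add0 : left_id pres_zero pres_add.
Proof. by elim/quotW=> s; rewrite (pres_addE [::]). Qed.

Lemma pres_addN : left_inverse pres_zero pres_opp pres_add.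
Proof.
move=> p; rewrite -[in X in pres_add _ X](reprK p).
rewrite (pres_addE (map _ _)).
apply/pres_eqP; elim: (repr p) => [|x s IHs] /=; first exact: pres_cong_refl.
set ns := map _ s in IHs *.
apply: (@pres_cong_trans _ _ ((ns ++ [:: pres_neg x]) ++ ([:: x] ++ s))).
  apply: (@pres_cong_cat _ _ (pres_neg x :: ns) _ (x :: s)).
    exact: (pres_cong_comm _ [:: pres_neg x] ns).
  exact: pres_cong_refl.
apply: pres_cong_trans IHs; rewrite -catA.
apply: pres_cong_cat (pres_cong_refl _ _) _.
exact: (pres_cong_cat (pres_negP x) (pres_cong_refl _ s)).
Qed.

HB.instance Definition _ :=
  GRing.isZmodule.Build presented pres_addA pres_addC pres_add0 pres_addN.

Definition pgen (x : pres_gen P) : presented := \pi_presented [:: x].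

Lemma pres_piE s : \pi_presented s = \sum_(x <- s) pgen x.
Proof.
elim: s => [|x s IHs]; first by rewrite big_nil.
by rewrite big_cons -IHs -[x :: s]cat1s -pres_addE.
Qed.

Section Lift.
Variables (G : zmodType) (h : pres_gen P -> G).
Hypothesis hP : forall s t, pres_rel s t ->
  \sum_(x <- s) h x = \sum_(x <- t) h x.

Lemma pres_cong_sum s t : pres_cong (@pres_rel P) s t ->
  \sum_(x <- s) h x = \sum_(x <- t) h x.
Proof.
elim=> {s t} [s t /hP|s|s t _ ->|t s u _ -> _ ->|s s' t t' _ IHs _ IHt|s t] //.
  by rewrite !big_cat /= IHs IHt.
by rewrite !big_cat /= addrC.
Qed.

(* Takes the proof [hP] so that the additive structure can be inferred.       *)
Definition pres_lift of (forall s t, pres_rel s t ->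
    \sum_(x <- s) h x = \sum_(x <- t) h x) : presented -> G :=
  fun p => \sum_(x <- repr p) h x.

Local Notation lift := (pres_lift hP).

Lemma pres_liftE s : lift (\pi_presented s) = \sum_(x <- s) h x.
Proof. by apply/pres_cong_sum/pres_eqP; rewrite reprK. Qed.

Lemma pres_lift_pgen x : lift (pgen x) = h x.
Proof. by rewrite pres_liftE big_seq1. Qed.

Lemma pres_lift_is_additive : zmod_morphism lift.
Proof.
have liftD p q : lift (p + q) = lift p + lift q.
  elim/quotW: p => s; elim/quotW: q => t.
  by rewrite [_ + _]pres_addE !pres_liftE big_cat.
by move=> p q; apply/eqP; rewrite eq_sym subr_eq -liftD subrK.
Qed.

HB.instance Definition _ :=
  GRing.isZmodMorphism.Build presented G lift pres_lift_is_additive.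

End Lift.

Lemma pres_ext (G : zmodType) (f g : {additive presented -> G}) :
  (forall x, f (pgen x) = g (pgen x)) -> f =1 g.
Proof.
move=> fg p; rewrite -[p]reprK pres_piE !raddf_sum.
exact: eq_bigr.
Qed.

End Presented.

Record bimod (R S : pzRingType) := Bimod {
  bimod_left :> lmodType R;
  ract : bimod_left -> S -> bimod_left;
  ractDl : forall m m' s, ract (m + m') s = ract m s + ract m' s;
  ractDr : forall m s s', ract m (s + s') = ract m s + ract m s';
  ractM : forall m s s', ract m (s * s') = ract (ract m s) s';
  ract1 : forall m, ract m 1 = m;
  ractZ : forall r m s, ract (r *: m) s = r *: ract m s
}.

Section Tensor.
Variables (R S : pzRingType) (M : bimod R S).

Section TensorDef.
Variable X : lmodType S.

Inductive tens_rel : seq (M * X) -> seq (M * X) -> Prop :=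
  | tens_relDl m m' x : tens_rel [:: (m + m', x)] [:: (m, x); (m', x)]
  | tens_relDr m x x' : tens_rel [:: (m, x + x')] [:: (m, x); (m, x')]
  | tens_relA m s x : tens_rel [:: (ract m s, x)] [:: (m, s *: x)]
  | tens_rel0 x : tens_rel [:: (0, x)] [::].

Lemma tens_negP (p : M * X) :
  pres_cong tens_rel [:: (- p.1, p.2); p] [::].
Proof.
case: p => m x /=.
apply: pres_cong_trans (pres_cong_rel (tens_rel0 x)).
by apply/pres_cong_sym; rewrite -(addNr m); apply/pres_cong_rel/tens_relDl.
Qed.

Definition tens_pres := Presentation tens_negP.

(* M ⊗_S X, with the left R-action of M.                                      *)
Definition tens : Type := presented tens_pres.

HB.instance Definition _ := GRing.Zmodule.on tens.

Definition tensor (m : M) (x : X) : tens := pgen ((m, x) : pres_gen tens_pres).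

Lemma tensorDl m m' x : tensor (m + m') x = tensor m x + tensor m' x.
Proof.
rewrite [RHS]pres_addE; apply/pres_eqP/pres_cong_rel; exact: tens_relDl.
Qed.
Lemma tensorDr m x x' : tensor m (x + x') = tensor m x + tensor m x'.
Proof.
rewrite [RHS]pres_addE; apply/pres_eqP/pres_cong_rel; exact: tens_relDr.
Qed.
Lemma tensorA m s x : tensor (ract m s) x = tensor m (s *: x).
Proof. by apply/pres_eqP/pres_cong_rel; apply: tens_relA. Qed.
Lemma tensor0l x : tensor 0 x = 0.
Proof. by apply: (addIr (tensor 0 x)); rewrite -tensorDl !add0r. Qed.
Lemma tensor0r m : tensor m 0 = 0.
Proof. by apply: (addIr (tensor m 0)); rewrite -tensorDr !add0r. Qed.

Lemma tens_ext (G : zmodType) (f g : {additive tens -> G}) :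
  (forall m x, f (tensor m x) = g (tensor m x)) -> f =1 g.
Proof. by move=> fg; apply: (@pres_ext tens_pres) => -[m x]; apply: fg. Qed.

Section TensLift.
Variables (G : zmodType) (h : M -> X -> G).
Hypothesis hDl : forall m m' x, h (m + m') x = h m x + h m' x.
Hypothesis hDr : forall m x x', h m (x + x') = h m x + h m x'.
Hypothesis hA : forall m s x, h (ract m s) x = h m (s *: x).

Lemma tens_lift_rel (s t : seq (M * X)) : tens_rel s t ->
  \sum_(p <- s) h p.1 p.2 = \sum_(p <- t) h p.1 p.2.
Proof.
case=> [m m' x|m x x'|m r x|x]; rewrite ?big_cons ?big_nil ?addr0 //=.
by apply: (addIr (h 0 x)); rewrite -hDl !add0r.
Qed.

Definition tens_lift : {additive tens -> G} :=
  @pres_lift tens_pres G (fun p => h p.1 p.2) tens_lift_rel.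

Lemma tens_liftE m x : tens_lift (tensor m x) = h m x.
Proof. exact: (@pres_lift_pgen tens_pres). Qed.
End TensLift.

Section TensScale.
Variable r : R.
Let h (m : M) (x : X) := tensor (r *: m) x.
Fact tens_scaleDl m m' x : h (m + m') x = h m x + h m' x.
Proof. by rewrite /h scalerDr tensorDl. Qed.
Fact tens_scaleDr m x x' : h m (x + x') = h m x + h m x'.
Proof. exact: tensorDr. Qed.
Fact tens_scaleA m s x : h (ract m s) x = h m (s *: x).
Proof. by rewrite /h -ractZ tensorA. Qed.

Definition tens_scale : {additive tens -> tens} :=
  tens_lift tens_scaleDl tens_scaleDr tens_scaleA.
Lemma tens_scaleE m x : tens_scale (tensor m x) = tensor (r *: m) x.
Proof. exact: tens_liftE. Qed.
End TensScale.

Fact tens_scalerA a b v : tens_scale a (tens_scale b v) = tens_scale (a * b) v.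
Proof.
apply: (@tens_ext _ (tens_scale a \o tens_scale b)%FUN) => m x /=.
by rewrite !tens_scaleE scalerA.
Qed.
Fact tens_scale1r : left_id 1 tens_scale.
Proof. by apply: (@tens_ext _ _ idfun) => m x; rewrite tens_scaleE scale1r. Qed.
Fact tens_scalerDr : right_distributive tens_scale +%R.
Proof. by move=> a; apply: raddfD. Qed.
Fact tens_scalerDl v : {morph tens_scale^~ v : a b / a + b}.
Proof.
move=> a b; apply: (@tens_ext _ _ (tens_scale a \+ tens_scale b)%FUN) => m x /=.
by rewrite !tens_scaleE scalerDl tensorDl.
Qed.

HB.instance Definition _ := GRing.Zmodule_isLmodule.Build R tens
  tens_scalerA tens_scale1r tens_scalerDr tens_scalerDl.

Lemma tensorZl r m x : tensor (r *: m) x = r *: tensor m x.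
Proof. by rewrite -tens_scaleE. Qed.

End TensorDef.

Section TensMap.
Variables (X X' : lmodType S) (u : {linear X -> X'}).
Let h (m : M) (x : X) := tensor m (u x).
Fact tens_mapDl m m' x : h (m + m') x = h m x + h m' x.
Proof. exact: tensorDl. Qed.
Fact tens_mapDr m x x' : h m (x + x') = h m x + h m x'.
Proof. by rewrite /h linearD tensorDr. Qed.
Fact tens_mapA m s x : h (ract m s) x = h m (s *: x).
Proof. by rewrite /h tensorA linearZ. Qed.

(* The R-linear map 1_M ⊗ u.                                                  *)
Definition tens_map : tens X -> tens X' :=
  tens_lift tens_mapDl tens_mapDr tens_mapA.

Lemma tens_mapE m x : tens_map (tensor m x) = tensor m (u x).
Proof. exact: tens_liftE. Qed.

HB.instance Definition _ := GRing.Additive.on tens_map.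

Fact tens_map_is_scalable : scalable tens_map.
Proof.
move=> r t.
apply: (@tens_ext _ _ (tens_map \o tens_scale X r)%FUN
                       (tens_scale X' r \o tens_map)%FUN) => m x /=.
by rewrite tens_scaleE !tens_mapE tens_scaleE.
Qed.
HB.instance Definition _ :=
  GRing.isScalable.Build R (tens X) (tens X') *:%R tens_map tens_map_is_scalable.
End TensMap.

End Tensor.

Arguments tensor {R S M X}.
Arguments tens_map {R S} M {X X'}.

Definition exact_at (U V W : nmodType) (f : U -> V) (g : V -> W) : Prop :=
  forall v, g v = 0 <-> exists u, f u = v.

Definition surjective_map (U V : Type) (f : U -> V) : Prop :=
  forall v, exists u, f u = v.

Definition short_exact (U V W : nmodType) (f : U -> V) (g : V -> W) : Prop :=
  [/\ injective f, exact_at f g & surjective_map g].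

Definition projective (R : pzRingType) (P : lmodType R) : Prop :=
  forall (V W : lmodType R) (p : {linear V -> W}) (f : {linear P -> W}),
    surjective_map p -> exists g : {linear P -> V}, forall x, p (g x) = f x.

Record proj_resolution (R : pzRingType) (X : lmodType R) := ProjResolution {
  res_obj :> nat -> lmodType R;
  res_d : forall n, {linear res_obj n.+1 -> res_obj n};
  res_aug : {linear res_obj 0 -> X};
  res_projective : forall n, projective (res_obj n);
  res_aug_surj : surjective_map res_aug;
  res_exact0 : exact_at (res_d 0) res_aug;
  res_exact : forall n, exact_at (res_d n.+1) (res_d n)
}.

(* The n-th cohomology of Hom(P, Y), and the n-th homology of M ⊗ P, vanish.  *)
Definition Hom_acyclic_at (R : pzRingType) (X Y : lmodType R)
    (P : proj_resolution X) (n : nat) : Prop :=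
  match n with
  | 0 => forall f : {linear P 0%N -> Y},
      (forall x, f (res_d P 0 x) = 0) -> forall x, f x = 0
  | k.+1 => forall f : {linear P k.+1 -> Y},
      (forall x, f (res_d P k.+1 x) = 0) ->
      exists g : {linear P k -> Y}, forall x, f x = g (res_d P k x)
  end.

Definition tens_acyclic_at (R S : pzRingType) (M : bimod R S) (X : lmodType S)
    (P : proj_resolution X) (n : nat) : Prop :=
  match n with
  | 0 => forall t : tens M (P 0%N), exists u, tens_map M (res_d P 0) u = t
  | k.+1 => forall t : tens M (P k.+1), tens_map M (res_d P k) t = 0 ->
      exists u, tens_map M (res_d P k.+1) u = t
  end.

(* Ext^n_R(X, Y) = 0 and Tor_n^S(M, X) = 0.  Both are computed from a         *)
(* projective resolution of X, which exists by [proj_resolution_exists] below *)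
(* and whose choice is immaterial.                                            *)
Definition Ext_zero (R : pzRingType) (n : nat) (X Y : lmodType R) : Prop :=
  forall P : proj_resolution X, Hom_acyclic_at Y P n.

Definition Tor_zero (R S : pzRingType) (n : nat) (M : bimod R S)
    (X : lmodType S) : Prop :=
  forall P : proj_resolution X, tens_acyclic_at M P n.

Section Free.
Variables (R : pzRingType) (K : choiceType).

Inductive free_rel : seq (R * K) -> seq (R * K) -> Prop :=
  | free_relD a b k : free_rel [:: (a + b, k)] [:: (a, k); (b, k)]
  | free_rel0 k : free_rel [:: (0, k)] [::].

Lemma free_negP (p : R * K) : pres_cong free_rel [:: (- p.1, p.2); p] [::].
Proof.
case: p => a k /=; apply: pres_cong_trans (pres_cong_rel (free_rel0 k)).
by apply/pres_cong_sym; rewrite -(addNr a); apply/pres_cong_rel/free_relD.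
Qed.

Definition free_pres := Presentation free_negP.

Definition free_mod : Type := presented free_pres.

HB.instance Definition _ := GRing.Zmodule.on free_mod.

Definition fterm (a : R) (k : K) : free_mod :=
  pgen ((a, k) : pres_gen free_pres).

Lemma ftermD a b k : fterm (a + b) k = fterm a k + fterm b k.
Proof.
rewrite [RHS]pres_addE; apply/pres_eqP/pres_cong_rel; exact: free_relD.
Qed.

Lemma free_ext (G : zmodType) (f g : {additive free_mod -> G}) :
  (forall a k, f (fterm a k) = g (fterm a k)) -> f =1 g.
Proof. by move=> fg; apply: (@pres_ext free_pres) => -[a k]; apply: fg. Qed.

Section FreeLift.
Variables (G : zmodType) (h : R -> K -> G).
Hypothesis hD : forall a b k, h (a + b) k = h a k + h b k.

Lemma free_lift_rel (s t : seq (R * K)) : free_rel s t ->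
  \sum_(p <- s) h p.1 p.2 = \sum_(p <- t) h p.1 p.2.
Proof.
case=> [a b k|k]; rewrite ?big_cons ?big_nil ?addr0 //=.
by apply: (addIr (h 0 k)); rewrite -hD !add0r.
Qed.

Definition free_lift : {additive free_mod -> G} :=
  @pres_lift free_pres G (fun p => h p.1 p.2) free_lift_rel.

Lemma free_liftE a k : free_lift (fterm a k) = h a k.
Proof. exact: (@pres_lift_pgen free_pres). Qed.
End FreeLift.

Section FreeScale.
Variable r : R.
Fact free_scaleD a b k :
  fterm (r * (a + b)) k = fterm (r * a) k + fterm (r * b) k.
Proof. by rewrite mulrDr ftermD. Qed.
Definition free_scale : {additive free_mod -> free_mod} :=
  free_lift (h := fun a k => fterm (r * a) k) free_scaleD.
Lemma free_scaleE a k : free_scale (fterm a k) = fterm (r * a) k.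
Proof. exact: free_liftE. Qed.
End FreeScale.

Fact free_scalerA a b v : free_scale a (free_scale b v) = free_scale (a * b) v.
Proof.
apply: (@free_ext _ (free_scale a \o free_scale b)%FUN) => c k /=.
by rewrite !free_scaleE mulrA.
Qed.
Fact free_scale1r : left_id 1 free_scale.
Proof. by apply: (@free_ext _ _ idfun) => a k; rewrite free_scaleE mul1r. Qed.
Fact free_scalerDr : right_distributive free_scale +%R.
Proof. by move=> a; apply: raddfD. Qed.
Fact free_scalerDl v : {morph free_scale^~ v : a b / a + b}.
Proof.
move=> a b; apply: (@free_ext _ _ (free_scale a \+ free_scale b)%FUN) => c k /=.
by rewrite !free_scaleE mulrDl ftermD.
Qed.

HB.instance Definition _ := GRing.Zmodule_isLmodule.Build R free_mod
  free_scalerA free_scale1r free_scalerDr free_scalerDl.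

Section FreeMap.
Variables (V : lmodType R) (v : K -> V).
Fact free_mapD a b k : (a + b) *: v k = a *: v k + b *: v k.
Proof. exact: scalerDl. Qed.

Definition free_map : free_mod -> V :=
  free_lift (h := fun a k => a *: v k) free_mapD.

HB.instance Definition _ := GRing.Additive.on free_map.

Lemma free_mapE a k : free_map (fterm a k) = a *: v k.
Proof. exact: free_liftE. Qed.

Fact free_map_is_scalable : scalable free_map.
Proof.
move=> r t.
apply: (@free_ext _ (free_map \o free_scale r)%FUN
                     (GRing.scale r \o free_map)%FUN) => a k /=.
by rewrite free_scaleE !free_mapE scalerA.
Qed.
HB.instance Definition _ :=
  GRing.isScalable.Build R free_mod V *:%R free_map free_map_is_scalable.
End FreeMap.

Lemma free_projective : projective free_mod.
Proof.
move=> V W p f p_surj.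
pose v k := projT1 (cid (p_surj (f (fterm 1 k)))).
exists (free_map v); apply: (@free_ext _ (p \o free_map v)%FUN f) => a k /=.
rewrite free_mapE linearZ /v; case: cid => /= _ ->; rewrite -linearZ.
by rewrite [_ *: _]free_scaleE mulr1.
Qed.

End Free.

Section ResolutionExists.
Variables (R : pzRingType) (X : lmodType R).

Record res_step := ResStep {
  step_src : lmodType R; step_tgt : lmodType R;
  step_map : {linear step_src -> step_tgt} }.

Definition cover_ker (U V : lmodType R) (d : {linear U -> V}) :
    {linear free_mod R {x : U | d x == 0} -> U} :=
  free_map (@sval U (fun x => d x == 0)).

Lemma cover_kerP (U V : lmodType R) (d : {linear U -> V}) :
  exact_at (cover_ker d) d.
Proof.
move=> u; split=> [/eqP du|[z <-]].
  by exists (fterm 1 (exist _ u du)); rewrite /cover_ker /= free_mapE scale1r.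
apply: (@free_ext _ _ _ (d \o cover_ker d)%FUN \0) => a x /=.
by rewrite /cover_ker /= free_mapE linearZ_LR (eqP (valP x)) scaler0.
Qed.

Definition next_step (s : res_step) : res_step :=
  ResStep (cover_ker (step_map s)).

Definition first_step : res_step := ResStep (free_map (fun x : X => x)).

Lemma proj_resolution_exists : inhabited (proj_resolution X).
Proof.
pose s n := iter n next_step first_step.
constructor; apply: (@ProjResolution R X (fun n => step_src (s n))
  (fun n => step_map (s n.+1)) (step_map (s 0%N))).
- by case=> [|n]; apply: free_projective.
- by move=> x; exists (fterm 1 x); rewrite /= free_mapE scale1r.
- exact: cover_kerP.
- by move=> n; apply: cover_kerP.
Qed.

End ResolutionExists.

Definition mod_class (R : pzRingType) := lmodType R -> Prop.

Section Cotorsion.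
Variable R : pzRingType.
Implicit Types C D S : mod_class R.

Definition left_perp S : mod_class R :=
  fun Y => forall Z : lmodType R, S Z -> Ext_zero 1 Y Z.

Definition right_perp S : mod_class R :=
  fun Y => forall Z : lmodType R, S Z -> Ext_zero 1 Z Y.

Definition cotorsion_pair C D : Prop :=
  (forall Y, C Y <-> left_perp D Y) /\ (forall Y, D Y <-> right_perp C Y).

Definition complete_pair C D : Prop :=
  forall Z : lmodType R,
    (exists (V U : lmodType R) (i : {linear V -> U}) (p : {linear U -> Z}),
       [/\ D V, C U & short_exact i p]) /\
    (exists (V U : lmodType R) (i : {linear Z -> V}) (p : {linear V -> U}),
       [/\ D V, C U & short_exact i p]).

Definition hereditary_pair C D : Prop :=
  forall (n : nat) (U V : lmodType R), (0 < n)%N -> C U -> D V ->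
    Ext_zero n U V.

Definition hereditary_complete_cotorsion_pair C D : Prop :=
  [/\ cotorsion_pair C D, complete_pair C D & hereditary_pair C D].

Definition mod_iso (U V : lmodType R) : Prop :=
  exists f : {linear U -> V}, bijective f.

End Cotorsion.

Section MoritaRing.
Variables (A B : pzRingType) (M : bimod B A) (N : bimod A B).

(* ((a, n), (m, b)) stands for the matrix with rows (a, n) and (m, b).        *)
Definition morita : Type := ((A * N) * (M * B))%type.

HB.instance Definition _ := GRing.Zmodule.copy morita ((A * N) * (M * B))%type.

Definition morita_one : morita := ((1, 0), (0, 1)).

Definition morita_mul (x y : morita) : morita :=
  let: ((a1, n1), (m1, b1)) := x in
  let: ((a2, n2), (m2, b2)) := y in
  ((a1 * a2, a1 *: n2 + ract n1 b2), (ract m1 a2 + b1 *: m2, b1 * b2)).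

Lemma ract0l (R S : pzRingType) (L : bimod R S) s : ract (0 : L) s = 0.
Proof. by apply: (addIr (ract (0 : L) s)); rewrite -ractDl !add0r. Qed.
Lemma ract0r (R S : pzRingType) (L : bimod R S) (m : L) : ract m 0 = 0.
Proof. by apply: (addIr (ract m 0)); rewrite -ractDr !add0r. Qed.

Fact morita_mulA : associative morita_mul.
Proof.
move=> [[a1 n1] [m1 b1]] [[a2 n2] [m2 b2]] [[a3 n3] [m3 b3]] /=.
rewrite !mulrA !scalerDr !ractDl !ractZ !ractM !scalerA.
by congr (_, _, (_, _)); rewrite addrA.
Qed.
Fact morita_mul1r : left_id morita_one morita_mul.
Proof.
move=> [[a n] [m b]] /=.
by rewrite !mul1r !scale1r !ract0l addr0 add0r.
Qed.
Fact morita_mulr1 : right_id morita_one morita_mul.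
Proof.
move=> [[a n] [m b]] /=.
by rewrite !mulr1 !scaler0 !ract1 addr0 add0r.
Qed.
Fact morita_mulDl : left_distributive morita_mul +%R.
Proof.
move=> [[a1 n1] [m1 b1]] [[a2 n2] [m2 b2]] [[a3 n3] [m3 b3]] /=.
by rewrite !mulrDl !scalerDl !ractDl; congr (_, _, (_, _)); apply: addrACA.
Qed.
Fact morita_mulDr : right_distributive morita_mul +%R.
Proof.
move=> [[a1 n1] [m1 b1]] [[a2 n2] [m2 b2]] [[a3 n3] [m3 b3]] /=.
by rewrite !mulrDr !scalerDr !ractDr; congr (_, _, (_, _)); apply: addrACA.
Qed.

HB.instance Definition _ := GRing.Zmodule_isPzRing.Build morita
  morita_mulA morita_mul1r morita_mulr1 morita_mulDl morita_mulDr.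

Record mtuple := MTuple {
  tup_X : lmodType A;
  tup_Y : lmodType B;
  tup_f : {linear tens N tup_Y -> tup_X};
  tup_g : {linear tens M tup_X -> tup_Y};
  tup_fg : forall t : tens N (tens M tup_X), tup_f (tens_map N tup_g t) = 0;
  tup_gf : forall t : tens M (tens N tup_Y), tup_g (tens_map M tup_f t) = 0
}.

(* The module corresponding to a tuple: pairs (x, y), on which the matrix     *)
(* with rows (a, n) and (m, b) acts by                                        *)
(*   (x, y) |-> (a x + f (n ⊗ y), g (m ⊗ x) + b y).                           *)
Definition tuple_mod (T : mtuple) : Type := (tup_X T * tup_Y T)%type.

Section TupleMod.
Variable T : mtuple.
Local Notation f n y := (tup_f T (tensor n y)).
Local Notation g m x := (tup_g T (tensor m x)).

HB.instance Definition _ :=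
  GRing.Zmodule.copy (tuple_mod T) (tup_X T * tup_Y T)%type.

Definition tuple_scale (l : morita) (z : tuple_mod T) : tuple_mod T :=
  let: ((a, n), (m, b)) := l in
  let: (x, y) := z in
  (a *: x + f n y, g m x + b *: y).

Fact tuple_scalerA l l' z :
  tuple_scale l (tuple_scale l' z) = tuple_scale (l * l') z.
Proof.
move: l l' z => [[a n] [m b]] [[a' n'] [m' b']] [x y] /=.
have fg0 m1 x1 : f n (g m1 x1) = 0.
  by have := tup_fg (tensor n (tensor m1 x1)); rewrite tens_mapE.
have gf0 n1 y1 : g m (f n1 y1) = 0.
  by have := tup_gf (tensor m (tensor n1 y1)); rewrite tens_mapE.
rewrite !tensorDl !tensorDr !linearD !tensorA !tensorZl /=.
rewrite !linearZ_LR !scalerDr !scalerA fg0 gf0 add0r addr0 /=.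
by congr (_, _); rewrite addrA.
Qed.
Fact tuple_scale1r : left_id 1 tuple_scale.
Proof.
move=> [x y]; rewrite /tuple_scale /= !tensor0l !linear0 !scale1r.
by rewrite addr0 add0r.
Qed.
Fact tuple_scalerDr : right_distributive tuple_scale +%R.
Proof.
move=> [[a n] [m b]] [x y] [x' y'] /=.
by rewrite !tensorDr !linearD !scalerDr; congr (_, _); apply: addrACA.
Qed.
Fact tuple_scalerDl z : {morph tuple_scale^~ z : l l' / l + l'}.
Proof.
move: z => [x y] [[a n] [m b]] [[a' n'] [m' b']] /=.
by rewrite !tensorDl !linearD !scalerDl; congr (_, _); apply: addrACA.
Qed.

HB.instance Definition _ := GRing.Zmodule_isLmodule.Build morita (tuple_mod T)
  tuple_scalerA tuple_scale1r tuple_scalerDr tuple_scalerDl.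

End TupleMod.

Definition tuple_class (CX : mod_class A) (CY : mod_class B) :
    mod_class morita :=
  fun Z => exists T : mtuple,
    [/\ CX (tup_X T), CY (tup_Y T) & mod_iso (tuple_mod T) Z].

Fact functor_TA_gf (X : lmodType A) (t : tens M (tens N (tens M X))) :
  idfun (tens_map M (\0 : tens N (tens M X) -> X) t) = 0.
Proof.
apply: (@tens_ext _ _ _ _ _ (tens_map M (\0 : tens N (tens M X) -> X)) \0).
by move=> m x; rewrite /= tens_mapE tensor0r.
Qed.

Fact functor_TB_fg (Y : lmodType B) (t : tens N (tens M (tens N Y))) :
  idfun (tens_map N (\0 : tens M (tens N Y) -> Y) t) = 0.
Proof.
apply: (@tens_ext _ _ _ _ _ (tens_map N (\0 : tens M (tens N Y) -> Y)) \0).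
by move=> m x; rewrite /= tens_mapE tensor0r.
Qed.

(* (X, M ⊗ X)_{0,1} and (N ⊗ Y, Y)_{1,0}.                                     *)
Definition functor_TA (X : lmodType A) : mtuple :=
  @MTuple X (tens M X) \0 idfun (fun _ => erefl) (@functor_TA_gf X).
Definition functor_TB (Y : lmodType B) : mtuple :=
  @MTuple (tens N Y) Y idfun \0 (@functor_TB_fg Y) (fun _ => erefl).

Definition TA_plus_TB (CU : mod_class A) (CV : mod_class B) :
    mod_class morita :=
  fun Z => exists (U : lmodType A) (V : lmodType B),
    [/\ CU U, CV V &
      mod_iso (tuple_mod (functor_TA U) * tuple_mod (functor_TB V))%type Z].

End MoritaRing.

Arguments tuple_class {A B} M N CX CY _.
Arguments TA_plus_TB {A B} M N CU CV _.

(* Main.v *)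
Require Import Defs.
From HB Require Import structures.
From mathcomp Require Import all_boot all_algebra.
From mathcomp Require Import boolp.

(* Write D for the class of tuples with components in X and Y.  Since T_A is
   left adjoint to (X, Y)_{f,g} |-> X, the Tor hypotheses give
   Ext^1(T_A L, Z) = Ext^1(L, Z_X) for L in U, and symmetrically for T_B, so D is
   the right orthogonal of T_A(U) + T_B(V).
   For completeness, special precovers U1 -> Z_X and V1 -> Z_Y induce a
   surjection T_A U1 + T_B V1 -> Z, whose kernel has components that are
   extensions of N ⊗ V1 and M ⊗ U1 by objects of X and Y; and embedding Z_X in X1
   with cokernel U1, pushing out Z_Y along M ⊗ Z_X -> M ⊗ X1, and then doing the
   same on the other side embeds Z in an object of D, with cokernel an extension
   of T_B V1 by T_A U1.
   D is closed under cokernels of monomorphisms, which makes the pair hereditary.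
   Finally, every Z in the left orthogonal of D is a retract of T_A U1 + T_B V1;
   when M ⊗ N = 0 = N ⊗ M its two structure maps are split monomorphisms, whose
   cokernels U2 and V2 satisfy Z = T_A U2 + T_B V2. *)

(** No long exact sequence is set up. Every argument with Ext^1 goes through [ext1], the extension
    of maps along all monomorphisms with cokernel L; it can be tested on one projective
    presentation, so that each standard consequence is a short chase. Ext^2 enters only as Ext^1 of
    a syzygy. Over the Morita ring the work is done with pairs of maps ([tmor]), in which exactness
    is componentwise. Exchanging A and B changes the base ring, so the statements on T_B come from
    those on T_A through a form of [ext1] written in components. A retract of T_A U1 + T_B V1 arises
    because a precover with kernel in D splits over an object of the left orthogonal. The condition
    M ⊗ N = 0 = N ⊗ M kills N ⊗ M ⊗ U1 and M ⊗ N ⊗ V1, which makes the structure maps of T_A U1 +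
    T_B V1 inclusions of direct summands; unlike the shape of the sum itself, this property visibly
    passes to retracts. *)

Set Implicit Arguments.
Unset Strict Implicit.
Unset Printing Implicit Defensive.

Import GRing.Theory.
Local Open Scope ring_scope.

(** * Kernels, cokernels and factorizations *)

Lemma bijective_of (U V : Type) (f : U -> V) :
  injective f -> surjective_map f -> bijective f.
Proof.
move=> f_inj f_surj; exists (fun v => projT1 (cid (f_surj v))) => [u|v].
  by case: cid => u' /= /f_inj.
by case: cid.
Qed.

(** Functions built by choosing preimages enter the [{linear _ -> _}] types here. *)
Lemma linear_of (R : pzRingType) (U V : lmodType R) (f : U -> V) :
  linear f -> exists g : {linear U -> V}, g =1 f.
Proof.
move=> f_lin; pose L := GRing.isLinear.Build _ _ _ _ f f_lin.
pose g : {linear U -> V} := HB.pack f L.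
by exists g.
Qed.

Section Kernel.
Variables (R : pzRingType) (U V : lmodType R) (f : {linear U -> V}).

Definition in_kernel : {pred U} := fun u => f u == 0.

Fact in_kernel_closed : submod_closed in_kernel.
Proof.
split=> [|a u v]; first by rewrite unfold_in /in_kernel linear0.
by rewrite !unfold_in /in_kernel linearP => /eqP-> /eqP->; rewrite scaler0 addr0.
Qed.
HB.instance Definition _ := GRing.isSubmodClosed.Build R U in_kernel in_kernel_closed.

Record kernel := Kernel { kernel_val :> U; _ : kernel_val \in in_kernel }.
HB.instance Definition _ := [isSub for kernel_val].
HB.instance Definition _ := [Choice of kernel by <:].
HB.instance Definition _ := [SubChoice_isSubLmodule of kernel by <:].

Lemma kernel_exists : exists (K : lmodType R) (i : {linear K -> U}),
  injective i /\ exact_at i f.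
Proof.
exists kernel.
have [|i iE] := @linear_of R kernel U \val; first by move=> a u v.
exists i; split=> [u v|u]; first by rewrite !iE => /val_inj.
split=> [/eqP fu|[k <-]]; last by rewrite iE; apply/eqP; exact: (valP k).
by exists (Kernel fu); rewrite iE.
Qed.
End Kernel.

Section Cokernel.
Local Open Scope quotient_scope.
Variables (R : pzRingType) (U V : lmodType R) (d : {linear U -> V}).

Definition coker_eqv : rel V := fun v w => `[< exists u, d u = v - w >].

Fact coker_eqv_equiv : equiv_class_of coker_eqv.
Proof.
split=> [v|v w|w v x].
- by apply/asboolP; exists 0; rewrite linear0 subrr.
- by apply/asboolP/asboolP=> -[u du]; exists (- u); rewrite linearN du opprB.
- move=> /asboolP[u du] /asboolP[u' du']; apply/asboolP.
  by exists (u + u'); rewrite linearD du du' addrA subrK.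
Qed.
Canonical coker_eqv_rel := EquivRelPack coker_eqv_equiv.

Definition cokernel : Type := {eq_quot coker_eqv}.
HB.instance Definition _ := Choice.on cokernel.
HB.instance Definition _ : EqQuotient V coker_eqv cokernel :=
  EqQuotient.on cokernel.

Lemma coker_eqP v w :
  (\pi_cokernel v = \pi_cokernel w) <-> exists u, d u = v - w.
Proof. by split=> [/eqmodP/asboolP|vw] //; apply/eqmodP/asboolP. Qed.

Definition coker_add (x y : cokernel) : cokernel :=
  \pi_cokernel (repr x + repr y).
Definition coker_opp (x : cokernel) : cokernel := \pi_cokernel (- repr x).
Definition coker_scale a (x : cokernel) : cokernel :=
  \pi_cokernel (a *: repr x).

Lemma coker_reprP v : exists u, d u = repr (\pi_cokernel v) - v.
Proof. by apply/coker_eqP; rewrite reprK. Qed.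

Fact coker_addE v w :
  coker_add (\pi_cokernel v) (\pi_cokernel w) = \pi_cokernel (v + w).
Proof.
apply/coker_eqP; have [u du] := coker_reprP v; have [u' du'] := coker_reprP w.
by exists (u + u'); rewrite linearD du du' opprD addrACA.
Qed.
Fact coker_oppE v : coker_opp (\pi_cokernel v) = \pi_cokernel (- v).
Proof.
apply/coker_eqP; have [u du] := coker_reprP v.
by exists (- u); rewrite linearN du opprB opprK addrC.
Qed.
Fact coker_scaleE a v : coker_scale a (\pi_cokernel v) = \pi_cokernel (a *: v).
Proof.
apply/coker_eqP; have [u du] := coker_reprP v.
by exists (a *: u); rewrite linearZ_LR du scalerBr.
Qed.

Fact coker_addA : associative coker_add.
Proof.
elim/quotW=> u; elim/quotW=> v; elim/quotW=> w.
by rewrite (coker_addE v w) (coker_addE u v) (coker_addE u) (coker_addE _ w) addrA.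
Qed.
Fact coker_addC : commutative coker_add.
Proof. by elim/quotW=> u; elim/quotW=> v; rewrite !coker_addE addrC. Qed.
Fact coker_add0 : left_id (\pi_cokernel 0) coker_add.
Proof. by elim/quotW=> u; rewrite coker_addE add0r. Qed.
Fact coker_addN : left_inverse (\pi_cokernel 0) coker_opp coker_add.
Proof. by elim/quotW=> u; rewrite coker_oppE coker_addE addNr. Qed.

HB.instance Definition _ :=
  GRing.isZmodule.Build cokernel coker_addA coker_addC coker_add0 coker_addN.

Fact coker_scalerA a b x :
  coker_scale a (coker_scale b x) = coker_scale (a * b) x.
Proof. by elim/quotW: x => u; rewrite (coker_scaleE b) (coker_scaleE a) coker_scaleE scalerA. Qed.
Fact coker_scale1r : left_id 1 coker_scale.
Proof. by elim/quotW=> u; rewrite coker_scaleE scale1r. Qed.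
Fact coker_scalerDr : right_distributive coker_scale +%R.
Proof.
move=> a; elim/quotW=> u; elim/quotW=> v.
by rewrite [_ + _]coker_addE (coker_scaleE _ u) (coker_scaleE _ v) coker_scaleE
  [RHS]coker_addE scalerDr.
Qed.
Fact coker_scalerDl x : {morph coker_scale^~ x : a b / a + b}.
Proof.
elim/quotW: x => u a b.
by rewrite (coker_scaleE a) (coker_scaleE b) coker_scaleE [RHS]coker_addE scalerDl.
Qed.

HB.instance Definition _ := GRing.Zmodule_isLmodule.Build R cokernel
  coker_scalerA coker_scale1r coker_scalerDr coker_scalerDl.

Lemma cokernel_exists : exists (Q : lmodType R) (p : {linear V -> Q}),
  surjective_map p /\ exact_at d p.
Proof.
have [|p pE] := @linear_of R V cokernel \pi_cokernel.
  by move=> a v w; rewrite -coker_addE -(coker_scaleE a v).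
exists cokernel, p; split=> [|v].
  by elim/quotW=> v; exists v; rewrite pE.
rewrite pE; split=> [/coker_eqP[u du]|[u <-]]; last first.
  by apply/coker_eqP; exists u; rewrite subr0.
by exists u; rewrite du subr0.
Qed.
End Cokernel.

Section Modules.
Variable R : pzRingType.
Implicit Types K L D E F G P Q : lmodType R.

Lemma descend E F G (s : {linear E -> F}) (h : {linear E -> G}) :
  surjective_map s -> (forall e, s e = 0 -> h e = 0) ->
  exists h' : {linear F -> G}, forall e, h' (s e) = h e.
Proof.
move=> s_surj hP; pose r y := projT1 (cid (s_surj y)).
have rK y : s (r y) = y by rewrite /r; case: cid.
have hE e e' : s e = s e' -> h e = h e'.
  by move=> see'; apply/eqP; rewrite -subr_eq0 -linearB hP // linearB see' subrr.
have [|h' h'E] := @linear_of R F G (h \o r).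
  by move=> a x y /=; rewrite -linearP; apply: hE; rewrite linearP !rK.
by exists h' => e; rewrite h'E; apply: hE; rewrite rK.
Qed.

Lemma colift K E G (i : {linear K -> E}) (h : {linear G -> E}) :
  injective i -> (forall x, exists k, i k = h x) ->
  exists h' : {linear G -> K}, forall x, i (h' x) = h x.
Proof.
move=> i_inj hP; pose r x := projT1 (cid (hP x)).
have rK x : i (r x) = h x by rewrite /r; case: cid.
have [|h' h'E] := @linear_of R G K r.
  by move=> a x y; apply: i_inj; rewrite linearP !rK linearP.
by exists h' => x; rewrite h'E.
Qed.

Lemma exact_comp0 K E F (i : {linear K -> E}) (p : {linear E -> F}) k :
  exact_at i p -> p (i k) = 0.
Proof. by move=> ip; apply/ip; exists k. Qed.

Lemma inj_linear0 K E (i : {linear K -> E}) :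
  (forall k, i k = 0 -> k = 0) -> injective i.
Proof.
move=> i0 k k' /eqP; rewrite -subr_eq0 -linearB => /eqP/i0/eqP.
by rewrite subr_eq0 => /eqP.
Qed.

Lemma linear_pair K E F (f : {linear K -> E}) (g : {linear K -> F}) :
  exists h : {linear K -> (E * F)%type}, forall k, h k = (f k, g k).
Proof.
have [|h hE] := @linear_of R K (E * F)%type (fun k => (f k, g k)).
  by move=> a x y; rewrite !linearP.
by exists h.
Qed.

Lemma linear_copair K E F (f : {linear E -> K}) (g : {linear F -> K}) :
  exists h : {linear (E * F)%type -> K}, forall z, h z = f z.1 + g z.2.
Proof.
have [|h hE] := @linear_of R (E * F)%type K (fun z => f z.1 + g z.2).
  by move=> a x y /=; rewrite !linearP scalerDr addrACA.
by exists h.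
Qed.

(* Ext^1(L, D) = 0; see [Ext_zero1P]. *)
Definition ext1 L D : Prop :=
  forall K E (i : {linear K -> E}) (p : {linear E -> L}), short_exact i p ->
  forall f : {linear K -> D}, exists g : {linear E -> D}, forall k, g (i k) = f k.

Lemma presentation_exists L :
  exists K P (i : {linear K -> P}) (p : {linear P -> L}),
    projective P /\ short_exact i p.
Proof.
have [P] := proj_resolution_exists L.
have [K [i [i_inj iP]]] := kernel_exists (res_aug P).
exists K, (P 0%N), i, (res_aug P); split; first exact: res_projective.
by split=> //; apply: res_aug_surj.
Qed.

End Modules.

(** * Vanishing of Ext *)

Section Ext1.
Variable R : pzRingType.
Implicit Types K L D E F G P Q : lmodType R.

(* E is a quotient of K + P0, and the kernel of K + P0 -> E is the image of
   (- f1, d) : P1 -> K + P0. *)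
Lemma chase_presentation L K E P0 P1 (i : {linear K -> E}) (p : {linear E -> L})
    (d : {linear P1 -> P0}) (aug : {linear P0 -> L}) :
  projective P0 -> surjective_map aug -> exact_at d aug ->
  short_exact i p ->
  exists (h : {linear P0 -> E}) (f1 : {linear P1 -> K})
         (s : {linear (K * P0)%type -> E}) (del : {linear P1 -> (K * P0)%type}),
  [/\ forall x, i (f1 x) = h (d x),
      forall z, s z = i z.1 + h z.2, forall x, del x = (- f1 x, d x) ,
      surjective_map s & exact_at del s].
Proof.
move=> P0_proj aug_surj d_aug [i_inj ip p_surj].
have [h hE] := P0_proj _ _ p aug p_surj.
(* [p] kills [h \o d], as [aug] kills [d], so the map lands in the image of [i]. *)
have [|f1 f1E] := @colift R K E P1 i (h \o d)%FUN i_inj.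
  by move=> x /=; apply/ip; rewrite hE; apply: exact_comp0.
have [s sE] := linear_copair i h.
have [del delE] := linear_pair (\- f1) d.
exists h, f1, s, del; split=> //.
- move=> e; have [x xE] := aug_surj (p e).
  have /ip[k kE] : p (e - h x) = 0 by rewrite linearB hE xE subrr.
  by exists (k, x); rewrite sE /= kE subrK.
- move=> [k x]; rewrite sE /=; split=> [kx|[y]]; last first.
    by rewrite delE => -[<- <-] /=; rewrite linearN f1E addNr.
  have /d_aug[y yE] : aug x = 0.
    by have := congr1 p kx; rewrite linearD linear0 (exact_comp0 _ ip) add0r hE.
  exists y; rewrite delE yE; congr (_, _); apply: i_inj.
  by rewrite /= linearN f1E /= yE; apply/eqP; rewrite eq_sym -addr_eq0 kx.
Qed.

(** The middle term of an extension of L by K' is a quotient of K' + P, so a map out of it is a pair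
    of maps (f, g) compatible on Q. Testing only maps constant on the fibres of [d] lets Q be either
    the kernel of [p] or the degree 1 term of a resolution. *)
Lemma ext1_of_cover L D P Q (d : {linear Q -> P}) (p : {linear P -> L}) :
  projective P -> surjective_map p -> exact_at d p ->
  (forall f : {linear Q -> D}, (forall x x', d x = d x' -> f x = f x') ->
    exists g : {linear P -> D}, forall x, f x = g (d x)) ->
  ext1 L D.
Proof.
move=> P_proj p_surj dp dD K' E i' p' ses f.
have [h [f1 [s [del [f1E sE delE s_surj dels]]]]] :=
  chase_presentation P_proj p_surj dp ses.
have i'_inj : injective i' by case: ses.
have [|g gE] := dD (f \o f1)%FUN.
  by move=> x x' xx' /=; congr (f _); apply: i'_inj; rewrite !f1E xx'.
have [t tE] := linear_copair f g.
(* On the image of [del], the map (f, g) takes the value - f (f1 x) + g (d x) = 0. *)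
have [|g' g'E] := @descend R _ _ _ s t s_surj.
  move=> _ /dels[x <-]; rewrite tE delE /= linearN.
  by rewrite -gE /= addNr.
exists g' => k.
have -> : i' k = s (k, 0) by rewrite sE /= linear0 addr0.
by rewrite g'E tE /= linear0 addr0.
Qed.

Lemma ext1_presentation L D K P (i : {linear K -> P}) (p : {linear P -> L}) :
  projective P -> short_exact i p ->
  (forall f : {linear K -> D}, exists g : {linear P -> D}, forall k, g (i k) = f k) ->
  ext1 L D.
Proof.
move=> P_proj [i_inj ip p_surj] extD.
apply: (ext1_of_cover P_proj p_surj ip) => f _.
by have [g gE] := extD f; exists g.
Qed.

(** By exactness, the 1-cocycles P1 -> D are exactly the maps that factor through the image of P1 in
    P0, which is the kernel of the augmentation. *)
Lemma ext1_acyclic L D (P : proj_resolution L) :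
  ext1 L D <-> Hom_acyclic_at D P 1.
Proof.
split=> [LD f fd|]; last first.
  move=> PD; apply: (ext1_of_cover (@res_projective _ _ P 0) (@res_aug_surj _ _ P)
    (@res_exact0 _ _ P)) => f fE.
  apply: PD => x; rewrite -[RHS](linear0 f); apply: fE.
  by rewrite linear0; apply/(@res_exact _ _ P 0); exists x.
have [K [i [i_inj iP]]] := kernel_exists (res_aug P).
have ses : short_exact i (res_aug P) by split=> //; apply: res_aug_surj.
have [|d dE] := @colift R K (P 0%N) (P 1%N) i (res_d P 0) i_inj.
  by move=> x; apply/iP/(@res_exact0 _ _ P); exists x.
have d_surj : surjective_map d.
  move=> k; have /(@res_exact0 _ _ P)[x xE] : res_aug P (i k) = 0 by apply: exact_comp0.
  by exists x; apply: i_inj; rewrite dE.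
have [|f' f'E] := @descend R _ _ _ d f d_surj.
  move=> x dx; have /(@res_exact _ _ P 0)[y <-] : res_d P 0 x = 0.
    by rewrite -dE dx linear0.
  exact: fd.
have [g gE] := LD _ _ _ _ ses f'.
by exists g => x; rewrite -dE gE f'E.
Qed.

(** [ext1] mentions no resolution, so acyclicity for one resolution gives it for all; the existence
    of a resolution is what makes the universally quantified [Ext_zero] informative. *)
Lemma Ext_zero1P L D : Ext_zero 1 L D <-> ext1 L D.
Proof.
split=> [LD|LD P]; last exact/ext1_acyclic.
by have [P] := proj_resolution_exists L; apply/(ext1_acyclic D P)/LD.
Qed.

(** Exactness of Hom(L, E) -> Hom(L, F) -> Ext^1(L, D). A lift of [f \o q] to the projective P sends
    the syzygy K into D; extending that map to P and subtracting it leaves a lift that vanishes on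
    K. *)
Lemma ext1_lift L D E F (i : {linear D -> E}) (p : {linear E -> F})
    (f : {linear L -> F}) :
  ext1 L D -> short_exact i p -> exists g : {linear L -> E}, forall x, p (g x) = f x.
Proof.
move=> LD [i_inj ip p_surj].
have [K [P [j [q [P_proj [j_inj jq q_surj]]]]]] := presentation_exists L.
have [h hE] := P_proj _ _ p (f \o q)%FUN p_surj.
have [|u uE] := @colift R D E K i (h \o j)%FUN i_inj.
  by move=> x /=; apply/ip; rewrite hE /= (exact_comp0 _ jq) linear0.
have [v vE] := LD _ _ j q (And3 j_inj jq q_surj) u.
have [|g gE] := @descend R P L E q (h \- (i \o v))%FUN q_surj.
  by move=> _ /jq[k <-] /=; rewrite vE uE /= subrr.
exists g => x; have [y <-] := q_surj x.
by rewrite gE /= linearB hE (exact_comp0 _ ip) subr0.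
Qed.

Lemma pullback_exists E F G (p : {linear E -> F}) (q : {linear G -> F}) :
  exists (W : lmodType R) (a : {linear W -> E}) (b : {linear W -> G}),
  [/\ forall w, p (a w) = q (b w),
      forall e g, p e = q g -> exists w, a w = e /\ b w = g,
      forall w w', a w = a w' -> b w = b w' -> w = w' &
      forall (T : lmodType R) (u : {linear T -> E}) (v : {linear T -> G}),
        (forall x, p (u x) = q (v x)) ->
        exists t : {linear T -> W}, forall x, a (t x) = u x /\ b (t x) = v x].
Proof.
have [t tE] := linear_copair p (\- q).
have [W [i [i_inj it]]] := kernel_exists t.
have [|a aE] := @linear_of R W E (fun w => (i w).1).
  by move=> x u v /=; rewrite linearP.
have [|b bE] := @linear_of R W G (fun w => (i w).2).
  by move=> x u v /=; rewrite linearP.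
have ex_w e g : p e = q g -> exists w, i w = (e, g).
  by move=> eg; apply/it; rewrite tE /= eg subrr.
exists W, a, b; split=> [w|e g /ex_w[w wE]|w w'|T u v uv].
- have := exact_comp0 w it; rewrite tE aE bE /= => /eqP.
  by rewrite subr_eq0 => /eqP.
- by exists w; rewrite aE bE wE.
- rewrite !aE !bE => a_w b_w; apply: i_inj.
  by rewrite [LHS]surjective_pairing [RHS]surjective_pairing a_w b_w.
- have [uv' uvE] := linear_pair u v.
  have [|c cE] := @colift R W _ T i uv' i_inj.
    by move=> x; rewrite uvE; apply: ex_w.
  by exists c => x; rewrite aE bE cE uvE.
Qed.

(** The given extension of L' is pulled back along [r] to an extension W of L, where [s' \o f]
    extends. The result is restricted to E and composed with [r']. *)
Lemma ext1_retract L L' D D' (s : {linear L' -> L}) (r : {linear L -> L'})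
    (s' : {linear D' -> D}) (r' : {linear D -> D'}) :
  cancel s r -> cancel s' r' -> ext1 L D -> ext1 L' D'.
Proof.
move=> sr s'r' LD K E i p [i_inj ip p_surj] f.
have [W [a [b [abE ab_ex ab_inj ab_lift]]]] := pullback_exists p r.
have [|j jE] := ab_lift K i \0.
  by move=> k /=; rewrite linear0 (exact_comp0 _ ip).
have [|g gE] := LD _ _ j b _ (s' \o f)%FUN.
  split.
  - by move=> k k' /(congr1 a); rewrite !(proj1 (jE _)) => /i_inj.
  - move=> w; split=> [bw|[k <-]]; last by rewrite (proj2 (jE _)).
    have /ip[k kE] : p (a w) = 0 by rewrite abE bw linear0.
    by exists k; apply: ab_inj; rewrite ?(proj1 (jE _)) ?(proj2 (jE _)).
  - move=> x; have [e eE] := p_surj (r x).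
    by have [w [_ <-]] := ab_ex e x eE; exists w.
(* Since r (s (p e)) = p e, the pair (e, s (p e)) is a point of the pullback. *)
have [|t tE] := ab_lift E idfun (s \o p)%FUN; first by move=> e /=; rewrite sr.
exists (r' \o (g \o t))%FUN => k /=.
suff -> : t (i k) = j k by rewrite gE /= s'r'.
apply: ab_inj; rewrite (proj1 (tE _), proj2 (tE _)) (proj1 (jE _), proj2 (jE _)) //=.
by rewrite (exact_comp0 _ ip) linear0.
Qed.

(** Let W be the preimage of L1 in the extension E of L2. It is an extension of L1, and E is an
    extension of L3 by W, so a map extends first to W and then to E. *)
Lemma ext1_extension_l L1 L2 L3 D (i : {linear L1 -> L2}) (p : {linear L2 -> L3}) :
  short_exact i p -> ext1 L1 D -> ext1 L3 D -> ext1 L2 D.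
Proof.
move=> [i_inj ip p_surj] LD1 LD3 K E j q [j_inj jq q_surj] f.
have [W [a [b [abE ab_ex ab_inj ab_lift]]]] := pullback_exists q i.
have [|c cE] := ab_lift K j \0.
  by move=> k /=; rewrite linear0 (exact_comp0 _ jq).
have [|g gE] := LD1 _ _ c b _ f.
  split.
  - by move=> k k' /(congr1 a); rewrite !(proj1 (cE _)) => /j_inj.
  - move=> w; split=> [bw|[k <-]]; last by rewrite (proj2 (cE _)).
    have /jq[k kE] : q (a w) = 0 by rewrite abE bw linear0.
    by exists k; apply: ab_inj; rewrite ?(proj1 (cE _)) ?(proj2 (cE _)).
  - move=> x; have [e eE] := q_surj (i x).
    by have [w [_ <-]] := ab_ex e x eE; exists w.
have [|h hE] := LD3 _ _ a (p \o q)%FUN _ g.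
  split.
  - move=> w w' aw; apply: ab_inj => //; apply: i_inj.
    by rewrite -!abE aw.
  - move=> e /=; split=> [/ip[x xE]|[w <-]].
      by have [w [<- _]] := ab_ex e x (esym xE); exists w.
    by rewrite abE (exact_comp0 _ ip).
  - move=> z; have [y <-] := p_surj z; have [x <-] := q_surj y.
    by exists x.
by exists h => k; rewrite -(proj1 (cE k)) hE gE.
Qed.

(** On a projective presentation of L: extend [p \o f] to P, lift the result to D2, and correct it
    by an extension of the error term, which takes values in D1. *)
Lemma ext1_extension_r L D1 D2 D3 (i : {linear D1 -> D2}) (p : {linear D2 -> D3}) :
  short_exact i p -> ext1 L D1 -> ext1 L D3 -> ext1 L D2.
Proof.
move=> [i_inj ip p_surj] LD1 LD3.
have [K [P [j [q [P_proj ses]]]]] := presentation_exists L.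
apply: (ext1_presentation P_proj ses) => f.
have [h hE] := LD3 _ _ j q ses (p \o f)%FUN.
have [h' h'E] := P_proj _ _ p h p_surj.
have [|u uE] := @colift R _ _ K i (f \- (h' \o j))%FUN i_inj.
  by move=> k /=; apply/ip; rewrite linearB h'E hE /= subrr.
have [v vE] := LD1 _ _ j q ses u.
exists (h' \+ (i \o v))%FUN => k /=.
by rewrite vE uE /= addrC subrK.
Qed.

(* Dimension shift: Ext^1(K, D1) = Ext^2(L, D1) for a syzygy K of L. *)
Lemma ext1_cokernel L K P D1 D2 D3 (j : {linear K -> P}) (q : {linear P -> L})
    (i : {linear D1 -> D2}) (p : {linear D2 -> D3}) :
  projective P -> short_exact j q -> short_exact i p ->
  ext1 K D1 -> ext1 L D2 -> ext1 L D3.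
Proof.
move=> P_proj ses ip KD1 LD2; apply: (ext1_presentation P_proj ses) => f.
have [g gE] := ext1_lift f KD1 ip.
have [h hE] := LD2 _ _ _ _ ses g.
by exists (p \o h)%FUN => k /=; rewrite hE gE.
Qed.

(** Q is P without its degree 0 term. In positive degrees [Hom_acyclic_at] sees only the
    differentials, so the two conditions are the same; degree 0 of Q has to be left out, since there
    the condition has another form. *)
Lemma proj_resolution_shift L (P : proj_resolution L) K (i : {linear K -> P 0%N}) :
  injective i -> exact_at i (res_aug P) ->
  exists Q : proj_resolution K,
    forall n D, Hom_acyclic_at D Q n.+1 <-> Hom_acyclic_at D P n.+2.
Proof.
move=> i_inj iP.
have [|d dE] := @colift R K (P 0%N) (P 1%N) i (res_d P 0) i_inj.
  by move=> x; apply/iP/(@res_exact0 _ _ P); exists x.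
have d_surj : surjective_map d.
  move=> k; have /(@res_exact0 _ _ P)[x xE] : res_aug P (i k) = 0 by apply: exact_comp0.
  by exists x; apply: i_inj; rewrite dE.
have dP : exact_at (res_d P 1) d.
  move=> x; split=> [dx|/(@res_exact _ _ P 0) dx].
    by apply/(@res_exact _ _ P 0); rewrite -dE dx linear0.
  by apply: i_inj; rewrite dE dx linear0.
by exists (@ProjResolution R K (fun n => P n.+1) (fun n => res_d P n.+1) d
  (fun n => @res_projective _ _ P n.+1) d_surj dP (fun n => @res_exact _ _ P n.+1)).
Qed.

Lemma ext1_syzygyP L (P : proj_resolution L) K (i : {linear K -> P 0%N}) D :
  injective i -> exact_at i (res_aug P) -> ext1 K D <-> Hom_acyclic_at D P 2.
Proof.
move=> i_inj iP; have [Q QP] := proj_resolution_shift i_inj iP.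
by rewrite -QP; apply: ext1_acyclic.
Qed.

(** The left class is closed under syzygies: Ext^1 of the syzygy K is Ext^2 of L, which vanishes on
    D. *)
Lemma hereditary_presentation (C D : mod_class R) L :
  cotorsion_pair C D -> hereditary_pair C D -> C L ->
  exists (K P : lmodType R) (j : {linear K -> P}) (q : {linear P -> L}),
    [/\ projective P, short_exact j q & C K].
Proof.
move=> [perpC _] CD CL; have [P] := proj_resolution_exists L.
have [K [i [i_inj iP]]] := kernel_exists (res_aug P).
exists K, (P 0%N), i, (res_aug P); split.
- exact: res_projective.
- by split=> //; apply: res_aug_surj.
- apply/perpC => Z DZ; apply/Ext_zero1P/(ext1_syzygyP Z i_inj iP).
  exact: (CD 2).
Qed.

(** * Closure properties of cotorsion classes and the hereditary condition *)

Lemma cotorsion_ext1 (C D : mod_class R) : cotorsion_pair C D ->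
  (forall L, C L <-> forall Z, D Z -> ext1 L Z) /\
  (forall Z, D Z <-> forall L, C L -> ext1 L Z).
Proof.
move=> [CP DP]; split=> L.
  by rewrite CP; split=> CL Z /CL/Ext_zero1P.
by rewrite DP; split=> DL Z /DL/Ext_zero1P.
Qed.

Definition cokernel_closed (D : mod_class R) : Prop :=
  forall D1 D2 D3 (i : {linear D1 -> D2}) (p : {linear D2 -> D3}),
  short_exact i p -> D D1 -> D D2 -> D D3.

Definition extension_closed (D : mod_class R) : Prop :=
  forall D1 D2 D3 (i : {linear D1 -> D2}) (p : {linear D2 -> D3}),
  short_exact i p -> D D1 -> D D3 -> D D2.

Definition retract_closed (D : mod_class R) : Prop :=
  forall D1 D2 (s : {linear D1 -> D2}) (r : {linear D2 -> D1}),
  cancel s r -> D D2 -> D D1.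

Lemma hereditary_cokernel_closed (C D : mod_class R) :
  cotorsion_pair C D -> hereditary_pair C D -> cokernel_closed D.
Proof.
move=> cot her; have [CP DP] := cotorsion_ext1 cot.
move=> D1 D2 D3 i p ip DD1 DD2; apply/DP => L CL.
have [K [P [j [q [P_proj ses CK]]]]] := hereditary_presentation cot her CL.
by apply: (ext1_cokernel P_proj ses ip); [move/DP: DD1|move/DP: DD2]; apply.
Qed.

Lemma cotorsion_extension_closed (C D : mod_class R) :
  cotorsion_pair C D -> extension_closed D.
Proof.
move=> /cotorsion_ext1[_ DP] D1 D2 D3 i p ip /DP DD1 /DP DD3; apply/DP => L CL.
by apply: ext1_extension_r ip _ _; auto.
Qed.

Lemma cotorsion_retract_closed (C D : mod_class R) :
  cotorsion_pair C D -> retract_closed C /\ retract_closed D.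
Proof.
move=> /cotorsion_ext1[CP DP]; split=> L L' s r sr.
  move=> /CP CL; apply/CP => Z /CL.
  exact: (@ext1_retract L' L Z Z s r idfun idfun sr (fun _ => erefl)).
move=> /DP DL; apply/DP => Z /DL.
exact: (@ext1_retract Z Z L' L idfun idfun s r (fun _ => erefl) sr).
Qed.

Lemma iso_inverse L L' (f : {linear L -> L'}) : bijective f ->
  exists g : {linear L' -> L}, cancel f g /\ cancel g f.
Proof.
move=> [h fh hf]; have [|g gE] := @linear_of R L' L h.
  by move=> a x y; apply: (can_inj fh); rewrite linearP !hf.
by exists g; split=> x; rewrite gE.
Qed.

Lemma retract_closed_iso (D : mod_class R) L L' :
  retract_closed D -> mod_iso L L' -> D L <-> D L'.
Proof.
move=> Dr [f /iso_inverse[g [fg gf]]].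
by split; [apply: Dr gf|apply: Dr fg].
Qed.

Lemma pushout_extension K E L D (i : {linear K -> E}) (p : {linear E -> L})
    (f : {linear K -> D}) :
  short_exact i p ->
  exists (W : lmodType R) (a : {linear E -> W}) (b : {linear D -> W})
         (t : {linear W -> L}),
  [/\ short_exact b t, forall k, a (i k) = b (f k) & forall e, t (a e) = p e].
Proof.
move=> [i_inj ip p_surj].
have [d dE] := linear_pair i (\- f).
have [W [c [c_surj dc]]] := cokernel_exists d.
have [|a aE] := @linear_of R E W (fun e => c (e, 0)).
  by move=> x u v; rewrite -linearP; congr (c (_, _)); rewrite /= scaler0 addr0.
have [|b bE] := @linear_of R D W (fun y => c (0, y)).
  by move=> x u v; rewrite -linearP; congr (c (_, _)); rewrite /= scaler0 addr0.
have [|q qE] := @linear_of R (E * D)%type L (fun z => p z.1).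
  by move=> x u v /=; rewrite linearP.
have [|t tE] := @descend R _ _ _ c q c_surj.
  by move=> _ /dc[k <-]; rewrite qE dE (exact_comp0 _ ip).
have ta e : t (a e) = p e by rewrite aE tE qE.
have aib k : a (i k) = b (f k).
  apply/eqP; rewrite -subr_eq0 aE bE -linearB; apply/eqP/dc; exists k.
  by rewrite dE; congr (_, _); rewrite /= ?subr0 ?sub0r.
have caE e y : c (e, y) = a e + b y.
  by rewrite aE bE -linearD; congr (c (_, _)); rewrite /= ?addr0 ?add0r.
exists W, a, b, t; split=> //; split.
- apply: inj_linear0 => y; rewrite bE => /dc[k]; rewrite dE => -[ik <-] /=.
  by have -> : k = 0; [apply: i_inj; rewrite ik linear0|rewrite linear0 oppr0].
- move=> w; have [[e y] <-] := c_surj w; split=> [|[y' <-]]; last first.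
    by rewrite bE tE qE linear0.
  rewrite tE qE /= => /ip[k <-]; exists (f k + y).
  by rewrite caE aib linearD.
- by move=> x; have [e <-] := p_surj x; exists (a e).
Qed.

(* An extension W of K by D1 is embedded in some D2 of the class: the map
   K = W/D1 -> D2/D1 extends to P and then lifts to P -> D2, which splits W. *)
Lemma left_perp_syzygy (D : mod_class R) L K P (j : {linear K -> P})
    (q : {linear P -> L}) :
  cokernel_closed D ->
  (forall Z : lmodType R, exists (Z' : lmodType R) (e : {linear Z -> Z'}), injective e /\ D Z') ->
  projective P -> short_exact j q -> left_perp D L -> left_perp D K.
Proof.
move=> D_coker D_embed P_proj ses DL D1 DD1.
apply/Ext_zero1P => K' E i p ip f.
have [W [a [b [t [[b_inj bt t_surj] aib ta]]]]] := pushout_extension f ip.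
have [D2 [e [e_inj DD2]]] := D_embed W.
have [D3 [c [c_surj ebc]]] := cokernel_exists (e \o b)%FUN.
have eb_inj : injective (e \o b) by apply: inj_comp.
have DD3 : D D3.
  exact: (D_coker _ _ _ (e \o b)%FUN c).
have [|g gE] := @descend R _ _ _ t (c \o e)%FUN t_surj.
  by move=> _ /bt[y <-]; apply: (exact_comp0 _ ebc).
have /Ext_zero1P LD3 := DL _ DD3.
have [g' g'E] := LD3 _ _ _ _ ses g.
have [h hE] := P_proj _ _ c g' c_surj.
(* The two terms agree after [c], so their difference takes values in D1. On K' the second term
   vanishes and the first is [e \o b \o f], hence [v] extends [f]. *)
have [|v vE] := @colift R _ _ E (e \o b)%FUN ((e \o a) \- (h \o (j \o p)))%FUN eb_inj.
  move=> x; apply/ebc.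
  by rewrite /= linearB hE g'E -ta gE /= subrr.
exists v => k; apply: eb_inj; rewrite vE /= aib.
by case: ip => _ ip _; rewrite (exact_comp0 _ ip) (linear0 j) (linear0 h) subr0.
Qed.

(** Induction on the degree: passing to a syzygy lowers it by one, and by [left_perp_syzygy] the
    syzygy stays in the left orthogonal. *)
Lemma left_perp_hereditary (D : mod_class R) :
  cokernel_closed D ->
  (forall Z : lmodType R, exists (Z' : lmodType R) (e : {linear Z -> Z'}), injective e /\ D Z') ->
  hereditary_pair (left_perp D) D.
Proof.
move=> D_coker D_embed [//|n] L Z _.
elim: n L => [|n IHn] L DL DZ; first exact: DL.
move=> P; have [K [i [i_inj iP]]] := kernel_exists (res_aug P).
have [Q QP] := proj_resolution_shift i_inj iP.
apply/QP/IHn => //.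
apply: (left_perp_syzygy D_coker D_embed (@res_projective _ _ P 0) _ DL).
by split; [exact: i_inj|exact: iP|exact: res_aug_surj].
Qed.

(** The third isomorphism theorem for Z in Z' in Z''. It gives the cokernel of a two-step embedding
    as an extension. *)
Lemma short_exact_comp (Z Z' Z'' C1 C2 : lmodType R) (i : {linear Z -> Z'}) (p : {linear Z' -> C1})
    (i' : {linear Z' -> Z''}) (p' : {linear Z'' -> C2}) :
  short_exact i p -> short_exact i' p' ->
  exists (C : lmodType R) (c : {linear Z'' -> C}) (u : {linear C1 -> C})
    (v : {linear C -> C2}), short_exact (i' \o i)%FUN c /\ short_exact u v.
Proof.
move=> [i_inj ip p_surj] [i'_inj ip' p'_surj].
have [C [c [c_surj ic]]] := cokernel_exists (i' \o i)%FUN.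
have [|u uE] := @descend R _ _ _ p (c \o i')%FUN p_surj.
  by move=> _ /ip[x <-]; apply: (exact_comp0 _ ic).
have [|v vE] := @descend R _ _ _ c p' c_surj.
  by move=> _ /ic[x <-]; apply: (exact_comp0 _ ip').
exists C, c, u, v; split; split=> //.
- exact: inj_comp.
- apply: inj_linear0 => y; have [x <-] := p_surj y.
  rewrite uE /= => /ic[z /i'_inj <-]; exact: (exact_comp0 _ ip).
- move=> y; have [x <-] := c_surj y; rewrite vE; split=> [/ip'[z <-]|[z]].
    by exists (p z); rewrite uE.
  by have [w <-] := p_surj z; rewrite uE /= -vE => <-; rewrite vE (exact_comp0 _ ip').
- by move=> z; have [x <-] := p'_surj z; exists (c x); rewrite vE.
Qed.
End Ext1.

Lemma short_exact_iso (R : pzRingType) (K E L K' E' L' : lmodType R)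
    (i : {linear K -> E}) (p : {linear E -> L})
    (u : {linear K' -> K}) (v : {linear E' -> E}) (w : {linear L' -> L}) :
  bijective u -> bijective v -> bijective w -> short_exact i p ->
  exists (i' : {linear K' -> E'}) (p' : {linear E' -> L'}),
  [/\ short_exact i' p', forall k, v (i' k) = i (u k) &
      forall e, w (p' e) = p (v e)].
Proof.
move=> /iso_inverse[u' [uK u'K]] /iso_inverse[v' [vK v'K]].
move=> /iso_inverse[w' [wK w'K]] [i_inj ip p_surj].
exists (v' \o (i \o u))%FUN, (w' \o (p \o v))%FUN; split=> //=; split.
- by do 2![apply: inj_comp; first exact: can_inj v'K || exact: i_inj]; apply: can_inj uK.
- move=> e /=; split=> [/(congr1 w)|[k <-]].
    rewrite w'K linear0 => /ip[k kE]; exists (u' k).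
    by rewrite u'K kE vK.
  by rewrite v'K (exact_comp0 _ ip) linear0.
- move=> l; have [e eE] := p_surj (w l).
  by exists (v' e); rewrite /= v'K eE wK.
Qed.

(** As [c] is already onto when restricted to U, every class of E modulo U has a representative in K
    = ker c; and K meets U in ker p = K'. *)
Lemma kernel_extension (R : pzRingType) (K' K E U S Z : lmodType R)
    (j : {linear K' -> U}) (p : {linear U -> Z})
    (k : {linear K -> E}) (c : {linear E -> Z})
    (l : {linear U -> E}) (r : {linear E -> S}) :
  short_exact j p -> short_exact k c -> short_exact l r ->
  (forall u, c (l u) = p u) ->
  exists (u : {linear K' -> K}) (v : {linear K -> S}), short_exact u v.
Proof.
move=> [j_inj jp p_surj] [k_inj kc c_surj] [l_inj lr r_surj] clp.
have [|u uE] := @colift _ _ _ _ k (l \o j)%FUN k_inj.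
  by move=> x; apply/kc; rewrite /= clp (exact_comp0 _ jp).
exists u, (r \o k)%FUN; split.
- by move=> x x' /(congr1 k); rewrite !uE => /l_inj/j_inj.
- move=> x /=; split=> [/lr[y yE]|[y <-]]; last by rewrite uE (exact_comp0 _ lr).
  have /jp[z zE] : p y = 0 by rewrite -clp yE (exact_comp0 _ kc).
  by exists z; apply: k_inj; rewrite uE /= zE.
- move=> s; have [e eE] := r_surj s; have [y yE] := p_surj (c e).
  have /kc[x xE] : c (e - l y) = 0 by rewrite linearB clp yE subrr.
  by exists x; rewrite /= xE linearB eE (exact_comp0 _ lr) subr0.
Qed.

Lemma short_exact_sum (R : pzRingType) (U S : lmodType R) :
  exists (l1 : {linear U -> (U * S)%type}) (r1 : {linear (U * S)%type -> S})
         (l2 : {linear S -> (U * S)%type}) (r2 : {linear (U * S)%type -> U}),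
  [/\ short_exact l1 r1, short_exact l2 r2,
      (forall u, l1 u = (u, 0)) /\ (forall s, l2 s = (0, s)) &
      (forall z, r1 z = z.2) /\ (forall z, r2 z = z.1)].
Proof.
have [l1 l1E] := linear_pair (idfun : {linear U -> U}) (\0 : {linear U -> S}).
have [l2 l2E] := linear_pair (\0 : {linear S -> U}) (idfun : {linear S -> S}).
have [|r1 r1E] := @linear_of R (U * S)%type S (fun z => z.2) => //.
have [|r2 r2E] := @linear_of R (U * S)%type U (fun z => z.1) => //.
exists l1, r1, l2, r2; split=> //; split.
- by move=> u u'; rewrite !l1E => -[].
- move=> [u s]; rewrite r1E /=; split=> [->|[u']]; last by rewrite l1E => -[].
  by exists u; rewrite l1E.
- by move=> s; exists (0, s); rewrite r1E.
- by move=> u u'; rewrite !l2E => -[].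
- move=> [u s]; rewrite r2E /=; split=> [->|[u']]; last by rewrite l2E => -[].
  by exists s; rewrite l2E.
- by move=> s; exists (s, 0); rewrite r2E.
Qed.

Lemma mod_iso_trans (R : pzRingType) (L1 L2 L3 : lmodType R) :
  mod_iso L1 L2 -> mod_iso L2 L3 -> mod_iso L1 L3.
Proof.
move=> [f f_bij] [g g_bij]; exists (g \o f)%FUN; exact: bij_comp.
Qed.

Lemma mod_iso_sym (R : pzRingType) (L L' : lmodType R) : mod_iso L L' -> mod_iso L' L.
Proof. by move=> [f /iso_inverse[g [fK gK]]]; exists g; exists f. Qed.

Lemma ext1_iso (R : pzRingType) (L L' Z Z' : lmodType R) :
  mod_iso L L' -> mod_iso Z Z' -> ext1 L Z -> ext1 L' Z'.
Proof.
move=> [f /iso_inverse[f' [fK f'K]]] [g /iso_inverse[g' [gK g'K]]].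
exact: ext1_retract f'K g'K.
Qed.

Lemma mod_iso_refl (R : pzRingType) (L : lmodType R) : mod_iso L L.
Proof. by exists idfun; exists id. Qed.

Lemma left_perp_extension (R : pzRingType) (S : mod_class R) :
  extension_closed (left_perp S).
Proof.
move=> L1 L2 L3 i p ip SL1 SL3 Z SZ; apply/Ext_zero1P.
by apply: (ext1_extension_l ip); apply/Ext_zero1P; auto.
Qed.

Lemma left_perp_iso (R : pzRingType) (S : mod_class R) L L' :
  mod_iso L L' -> left_perp S L -> left_perp S L'.
Proof.
move=> iso SL Z SZ; apply/Ext_zero1P/(ext1_iso iso (mod_iso_refl Z))/Ext_zero1P.
exact: SL.
Qed.


(** * Tensor products *)

Section TensorExact.
Variables (R S : pzRingType) (M : bimod R S).
Implicit Types X Y Z K L E : lmodType S.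

Lemma tens_ind X (Q : tens M X -> Prop) :
  Q 0 -> (forall t u, Q t -> Q u -> Q (t + u)) -> (forall m x, Q (tensor m x)) ->
  forall t, Q t.
Proof.
move=> Q0 QD QT t; rewrite -[t]reprK pres_piE.
elim: (repr t) => [|[m x] s IHs]; first by rewrite big_nil.
by rewrite big_cons; apply: QD => //; apply: QT.
Qed.

Lemma tens_linear X (G : lmodType R) (h : M -> X -> G) :
  (forall m m' x, h (m + m') x = h m x + h m' x) ->
  (forall m x x', h m (x + x') = h m x + h m x') ->
  (forall m s x, h (ract m s) x = h m (s *: x)) ->
  (forall r m x, h (r *: m) x = r *: h m x) ->
  exists f : {linear tens M X -> G}, forall m x, f (tensor m x) = h m x.
Proof.
move=> hDl hDr hA hZ; have [|f fE] := linear_of (f := tens_lift hDl hDr hA).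
  move=> r t u; rewrite raddfD; congr (_ + _); elim/tens_ind: t => [|t v IHt IHv|m x].
  - by rewrite scaler0 raddf0 scaler0.
  - by rewrite (scalerDr r t v) !raddfD IHt IHv.
  - by rewrite -(tensorZl r m x) !tens_liftE hZ.
by exists f => m x; rewrite fE tens_liftE.
Qed.

Lemma tens_map_comp X Y Z (u : {linear Y -> Z}) (v : {linear X -> Y})
    (w : {linear X -> Z}) :
  (forall x, w x = u (v x)) ->
  forall t, tens_map M w t = tens_map M u (tens_map M v t).
Proof.
move=> wE; apply: (@tens_ext _ _ _ _ _ _ (tens_map M u \o tens_map M v)%FUN).
by move=> m x /=; rewrite !tens_mapE wE.
Qed.

Lemma eq_tens_map X Y (u v : {linear X -> Y}) :
  u =1 v -> tens_map M u =1 tens_map M v.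
Proof. by move=> uv; apply: tens_ext => m x /=; rewrite !tens_mapE uv. Qed.

Lemma tens_map_id X (u : {linear X -> X}) :
  (forall x, u x = x) -> forall t, tens_map M u t = t.
Proof.
by move=> uE; apply: (@tens_ext _ _ _ _ _ _ idfun) => m x /=; rewrite tens_mapE uE.
Qed.

Lemma tens_map0 X Y (u : {linear X -> Y}) :
  (forall x, u x = 0) -> forall t, tens_map M u t = 0.
Proof.
move=> uE; apply: (@tens_ext _ _ _ _ _ _ \0) => m x /=.
by rewrite tens_mapE uE tensor0r.
Qed.

Lemma tens_map_surj X Y (u : {linear X -> Y}) :
  surjective_map u -> surjective_map (tens_map M u).
Proof.
move=> u_surj; elim/tens_ind=> [|t t' [v <-] [v' <-]|m y].
- by exists 0; rewrite linear0.
- by exists (v + v'); rewrite linearD.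
- by have [x <-] := u_surj y; exists (tensor m x); rewrite tens_mapE.
Qed.

(* Right exactness: the projection of M ⊗ E onto the cokernel of 1 ⊗ i factors
   through M ⊗ L. *)
Lemma tens_exact K E L (i : {linear K -> E}) (p : {linear E -> L}) :
  exact_at i p -> surjective_map p -> exact_at (tens_map M i) (tens_map M p).
Proof.
move=> ip p_surj t; split=> [pt|[u <-]]; last first.
  rewrite -(@tens_map_comp _ _ _ _ _ (p \o i)%FUN) // tens_map0 // => x.
  exact: (exact_comp0 _ ip).
have [Q [c [c_surj ic]]] := cokernel_exists (tens_map M i).
(* A set-theoretic section of [p]: modulo the image of 1 ⊗ i the choice of the preimage does not
   matter, which makes m ⊗ x |-> c (m ⊗ r x) bilinear. *)
pose r x := projT1 (cid (p_surj x)).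
have rE m e : c (tensor m (r (p e))) = c (tensor m e).
  rewrite /r; case: cid => e' /= ee'; apply/eqP; rewrite -subr_eq0 -linearB.
  have /ip[k kE] : p (e' - e) = 0 by rewrite linearB ee' subrr.
  have -> : tensor m e' - tensor m e = tensor m (i k).
    by rewrite kE; apply/eqP; rewrite subr_eq -tensorDr subrK.
  by apply/eqP/ic; exists (tensor m k); apply: tens_mapE.
have rK x : p (r x) = x by rewrite /r; case: cid.
have [||||f fE] := @tens_linear L Q (fun m x => c (tensor m (r x))).
- by move=> m m' x; rewrite tensorDl linearD.
- move=> m x x'; rewrite -linearD -tensorDr -[in RHS]rE.
  by rewrite linearD !rK.
- by move=> m s x; rewrite tensorA -rE linearZ_LR rK.
- by move=> a m x; rewrite tensorZl linearZ_LR.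
apply/ic; suff <- : f (tens_map M p t) = c t by rewrite pt linear0.
move: t {pt}; apply: (@tens_ext _ _ _ _ _ (f \o tens_map M p)%FUN) => m e /=.
by rewrite tens_mapE fE rE.
Qed.

(** By [chase_presentation], E is the cokernel of (- f1, d) : P1 -> K + P0. If t dies in M ⊗ E,
    right exactness writes (t, 0) as the image of some w in M ⊗ P1. The second component says that w
    is a cycle, hence a boundary since Tor_1 vanishes; the first then gives t = 0, because [f1]
    kills the image of P2. *)
Lemma Tor_zero_inj L K E (i : {linear K -> E}) (p : {linear E -> L}) :
  Tor_zero 1 M L -> short_exact i p -> injective (tens_map M i).
Proof.
move=> torL ip; apply: inj_linear0 => t it.
have [P] := proj_resolution_exists L.
have [h [f1 [s [del [f1E sE delE s_surj dels]]]]] :=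
  chase_presentation (@res_projective _ _ P 0) (@res_aug_surj _ _ P)
    (@res_exact0 _ _ P) ip.
have [|inl inlE] := @linear_of S K (K * P 0%N)%type (fun k => (k, 0)).
  by move=> a k k'; congr (_, _); rewrite /= scaler0 addr0.
have [|pr1 pr1E] := @linear_of S (K * P 0%N)%type K (fun z => z.1).
  by move=> a k k'.
have [|pr2 pr2E] := @linear_of S (K * P 0%N)%type (P 0%N) (fun z => z.2).
  by move=> a k k'.
have /(tens_exact dels s_surj)[w wE] : tens_map M s (tens_map M inl t) = 0.
  rewrite -(@tens_map_comp _ _ _ _ _ i) // => k.
  by rewrite inlE sE /= linear0 addr0.
have dw : tens_map M (res_d P 0) w = 0.
  rewrite (@tens_map_comp _ _ _ pr2 del) => [|x]; last by rewrite delE pr2E.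
  rewrite wE -(@tens_map_comp _ _ _ _ _ (\0 : {linear K -> P 0%N})) => [|k].
    exact: tens_map0.
  by rewrite inlE pr2E.
have [v vE] := torL P w dw.
have <- : tens_map M pr1 (tens_map M inl t) = t.
  by rewrite -(@tens_map_comp _ _ _ _ _ idfun) ?tens_map_id // => k; rewrite inlE pr1E.
rewrite -wE -vE.
rewrite -(@tens_map_comp _ _ _ _ _ (\- f1)) => [|x]; last by rewrite delE pr1E.
rewrite -(@tens_map_comp _ _ _ _ _ (\- f1 \o res_d P 1)%FUN) //.
apply: tens_map0 => x /=; case: ip => i_inj _ _; apply: i_inj.
rewrite linearN f1E (_ : res_d P 0 _ = 0) ?linear0 ?oppr0 //.
by apply/(@res_exact _ _ P 0); exists x.
Qed.
End TensorExact.

(** For fixed x, the B-linear map m |-> m ⊗ x sends n ⊗ m, which is 0 in N ⊗ M, to n ⊗ (m ⊗ x). This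
    avoids the associativity isomorphism. *)
Lemma tens_tens0 (A B : pzRingType) (M : bimod B A) (N : bimod A B)
    (X : lmodType A) : (forall t : tens N M, t = 0) ->
  forall t : tens N (tens M X), t = 0.
Proof.
move=> NM0; elim/tens_ind=> [|t u -> ->|n t]; rewrite ?addr0 //.
elim/tens_ind: t => [|t u IHt IHu|m x]; first exact: tensor0r.
  by rewrite tensorDr IHt IHu addr0.
have [|h hE] := @linear_of B M (tens M X) (fun m => tensor m x).
  by move=> b m1 m2; rewrite tensorDl tensorZl.
have <- : h m = tensor m x by rewrite hE.
by rewrite -(tens_mapE h n m) (NM0 (tensor n m)) linear0.
Qed.


(** * Modules over the Morita ring as tuples *)

Section Corner.
Variables (S : pzRingType) (e : S) (Z : lmodType S).

Definition in_corner : {pred Z} := fun z => e *: z == z.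

Fact in_corner_closed : zmod_closed in_corner.
Proof.
split=> [|u v]; first by rewrite unfold_in /in_corner scaler0.
by rewrite !unfold_in /in_corner scalerBr => /eqP-> /eqP->.
Qed.
HB.instance Definition _ := GRing.isZmodClosed.Build Z in_corner in_corner_closed.

Record corner := Corner { corner_val : Z; _ : corner_val \in in_corner }.
HB.instance Definition _ := [isSub for corner_val].
HB.instance Definition _ := [Choice of corner by <:].
HB.instance Definition _ := [SubChoice_isSubZmodule of corner by <:].
End Corner.

(* For a ring homomorphism iota that need not preserve 1, the part of Z on which
   iota 1 acts as the identity is an R-module. *)
Lemma corner_exists (R S : pzRingType) (iota : R -> S) (Z : lmodType S) :
  (forall a b, iota (a + b) = iota a + iota b) ->
  (forall a b, iota (a * b) = iota a * iota b) ->
  exists (X : lmodType R) (v : X -> Z), [/\ injective v,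
    forall a x y, v (a *: x + y) = iota a *: v x + v y &
    forall z, iota 1 *: z = z <-> exists x, v x = z].
Proof.
move=> iD iM; pose C := corner (iota 1) Z.
have valC (x : C) : iota 1 *: val x = val x by apply/eqP; exact: (valP x).
have scaleP a (x : C) : iota a *: val x \in @in_corner S (iota 1) Z.
  by rewrite unfold_in /in_corner scalerA -iM mul1r.
pose sc a (x : C) : C := Corner (scaleP a x).
have scA a b x : sc a (sc b x) = sc (a * b) x.
  by apply: val_inj; rewrite /= scalerA iM.
have sc1 : left_id 1 sc by move=> x; apply: val_inj; rewrite /= valC.
have scDr : right_distributive sc +%R.
  by move=> a x y; apply: val_inj; rewrite /= scalerDr.
have scDl x : {morph sc^~ x : a b / a + b}.
  by move=> a b; apply: val_inj; rewrite /= iD scalerDl.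
pose L := GRing.Zmodule_isLmodule.Build R C scA sc1 scDr scDl.
pose X : lmodType R := HB.pack C L.
exists X, val; split=> [|a x y|z]; first exact: val_inj; first by [].
by split=> [/eqP ez|[x <-]]; [exists (Corner ez)|apply: valC].
Qed.

Section Tuples.
Variables (A B : pzRingType) (M : bimod B A) (N : bimod A B).
Local Notation Lam := (morita M N).

Definition entA (a : A) : Lam := ((a, 0), (0, 0)).
Definition entN (n : N) : Lam := ((0, n), (0, 0)).
Definition entM (m : M) : Lam := ((0, 0), (m, 0)).
Definition entB (b : B) : Lam := ((0, 0), (0, b)).

Lemma morita_eq (a a' : A) (n n' : N) (m m' : M) (b b' : B) :
  a = a' -> n = n' -> m = m' -> b = b' ->
  ((a, n), (m, b)) = ((a', n'), (m', b')) :> Lam.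
Proof. by move=> -> -> -> ->. Qed.

Definition ent_simp := (mulr0, mul0r, mulr1, mul1r, scale0r, scale1r,
  scaler0, ract0l, ract0r, ract1, addr0, add0r).

Lemma entAA a a' : entA a * entA a' = entA (a * a').
Proof. by apply: morita_eq; rewrite ?ent_simp. Qed.
Lemma entAN a n : entA a * entN n = entN (a *: n).
Proof. by apply: morita_eq; rewrite ?ent_simp. Qed.
Lemma entNB n b : entN n * entB b = entN (ract n b).
Proof. by apply: morita_eq; rewrite ?ent_simp. Qed.
Lemma entBB b b' : entB b * entB b' = entB (b * b').
Proof. by apply: morita_eq; rewrite ?ent_simp. Qed.
Lemma entBM b m : entB b * entM m = entM (b *: m).
Proof. by apply: morita_eq; rewrite ?ent_simp. Qed.
Lemma entMA m a : entM m * entA a = entM (ract m a).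
Proof. by apply: morita_eq; rewrite ?ent_simp. Qed.
Lemma entAB a b : entA a * entB b = 0.
Proof. by apply: morita_eq; rewrite ?ent_simp. Qed.
Lemma entBA a b : entB b * entA a = 0.
Proof. by apply: morita_eq; rewrite ?ent_simp. Qed.
Lemma entNA n a : entN n * entA a = 0.
Proof. by apply: morita_eq; rewrite ?ent_simp. Qed.
Lemma entMB m b : entM m * entB b = 0.
Proof. by apply: morita_eq; rewrite ?ent_simp. Qed.
Lemma entNM n m : entN n * entM m = 0.
Proof. by apply: morita_eq; rewrite ?ent_simp. Qed.
Lemma entMN n m : entM m * entN n = 0.
Proof. by apply: morita_eq; rewrite ?ent_simp. Qed.

Lemma entAD a a' : entA (a + a') = entA a + entA a'.
Proof. by apply: morita_eq; rewrite ?ent_simp. Qed.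
Lemma entBD b b' : entB (b + b') = entB b + entB b'.
Proof. by apply: morita_eq; rewrite ?ent_simp. Qed.
Lemma entND n n' : entN (n + n') = entN n + entN n'.
Proof. by apply: morita_eq; rewrite ?ent_simp. Qed.
Lemma entMD m m' : entM (m + m') = entM m + entM m'.
Proof. by apply: morita_eq; rewrite ?ent_simp. Qed.

Lemma ent_decomp (a : A) (n : N) (m : M) (b : B) :
  ((a, n), (m, b)) = entA a + entN n + (entM m + entB b) :> Lam.
Proof. by apply: morita_eq; rewrite /= ?ent_simp. Qed.

Lemma ent1 : 1 = entA 1 + entB 1 :> Lam.
Proof. by apply: morita_eq; rewrite ?ent_simp. Qed.

Lemma mtuple_exists (X : lmodType A) (Y : lmodType B)
    (f : {linear tens N Y -> X}) (g : {linear tens M X -> Y}) :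
  (forall n m x, f (tensor n (g (tensor m x))) = 0) ->
  (forall m n y, g (tensor m (f (tensor n y))) = 0) ->
  (forall t : tens N (tens M X), f (tens_map N g t) = 0) /\
  (forall t : tens M (tens N Y), g (tens_map M f t) = 0).
Proof.
move=> fg gf; split.
  apply: (@tens_ext _ _ _ _ _ (f \o tens_map N g)%FUN \0) => n t /=.
  rewrite tens_mapE; elim/tens_ind: t => [|t u IHt IHu|m x]; last exact: fg.
    by rewrite linear0 tensor0r linear0.
  by rewrite linearD tensorDr linearD IHt IHu addr0.
apply: (@tens_ext _ _ _ _ _ (g \o tens_map M f)%FUN \0) => n t /=.
rewrite tens_mapE; elim/tens_ind: t => [|t u IHt IHu|m x]; last exact: gf.
  by rewrite linear0 tensor0r linear0.
by rewrite linearD tensorDr linearD IHt IHu addr0.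
Qed.

(** Peirce decomposition: the components are the parts of Z fixed by the idempotents [entA 1] and
    [entB 1], whose sum is 1, and the structure maps are the actions of the off-diagonal entries.
    The composites vanish because [entN n * entM m = 0] and [entM m * entN n = 0]. *)
Lemma tuple_mod_exists (Z : lmodType Lam) :
  exists (T : mtuple M N) (phi : {linear tuple_mod T -> Z}), bijective phi.
Proof.
have [|X [vX [vX_inj vXP vXE]]] := corner_exists Z entAD.
  by move=> a a'; rewrite entAA.
have [|Y [vY [vY_inj vYP vYE]]] := corner_exists Z entBD.
  by move=> b b'; rewrite entBB.
have vX1 x : entA 1 *: vX x = vX x by apply/vXE; exists x.
have vY1 y : entB 1 *: vY y = vY y by apply/vYE; exists y.
have vXD x x' : vX (x + x') = vX x + vX x' by rewrite -[x in LHS]scale1r vXP vX1.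
have vYD y y' : vY (y + y') = vY y + vY y' by rewrite -[y in LHS]scale1r vYP vY1.
have vX0 : vX 0 = 0 by apply: (addrI (vX 0)); rewrite -vXD !addr0.
have vY0 : vY 0 = 0 by apply: (addrI (vY 0)); rewrite -vYD !addr0.
have vXZ a x : vX (a *: x) = entA a *: vX x by rewrite -[_ *: x]addr0 vXP vX0 addr0.
have vYZ b y : vY (b *: y) = entB b *: vY y by rewrite -[_ *: y]addr0 vYP vY0 addr0.
have fP n y : exists x, vX x = entN n *: vY y.
  by apply/vXE; rewrite scalerA entAN scale1r.
have gP m x : exists y, vY y = entM m *: vX x.
  by apply/vYE; rewrite scalerA entBM scale1r.
pose f0 n y := projT1 (cid (fP n y)).
have f0E n y : vX (f0 n y) = entN n *: vY y by rewrite /f0; case: cid.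
pose g0 m x := projT1 (cid (gP m x)).
have g0E m x : vY (g0 m x) = entM m *: vX x by rewrite /g0; case: cid.
have [||||f fE] := @tens_linear _ _ N Y X f0.
- by move=> n n' y; apply: vX_inj; rewrite vXD !f0E entND scalerDl.
- by move=> n y y'; apply: vX_inj; rewrite vXD !f0E vYD scalerDr.
- by move=> n b y; apply: vX_inj; rewrite !f0E vYZ scalerA entNB.
- by move=> a n y; apply: vX_inj; rewrite vXZ !f0E scalerA entAN.
have [||||g gE] := @tens_linear _ _ M X Y g0.
- by move=> n n' y; apply: vY_inj; rewrite vYD !g0E entMD scalerDl.
- by move=> n y y'; apply: vY_inj; rewrite vYD !g0E vXD scalerDr.
- by move=> n b y; apply: vY_inj; rewrite !g0E vXZ scalerA entMA.
- by move=> a n y; apply: vY_inj; rewrite vYZ !g0E scalerA entBM.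
have [||fg gf] := @mtuple_exists X Y f g.
- move=> n m x; rewrite gE fE; apply: vX_inj.
  by rewrite f0E g0E scalerA entNM scale0r vX0.
- move=> m n y; rewrite gE fE; apply: vY_inj.
  by rewrite g0E f0E scalerA entMN scale0r vY0.
pose T := MTuple fg gf.
have [|phi phiE] := @linear_of Lam (tuple_mod T) Z (fun z => vX z.1 + vY z.2).
  move=> [[a n] [m b]] [x y] [x' y'] /=.
  rewrite !vXD !vYD fE gE !vXZ !vYZ f0E g0E ent_decomp.
  rewrite -[vX x in RHS]vX1 -[vY y in RHS]vY1 !scalerDr !scalerDl.
  rewrite !scalerA entAA entAB entNA entMA entMB entBA entNB entBB !scale0r.
  rewrite !mulr1 !ract1 !addr0 !add0r.
  by rewrite [LHS]addrACA; congr (_ + _); rewrite addrACA.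
have vAB x y : entA 1 *: (vX x + vY y) = vX x /\ entB 1 *: (vX x + vY y) = vY y.
  rewrite -(vX1 x) -(vY1 y) !scalerDr !scalerA entAA entAB entBA entBB !mulr1.
  by rewrite !scale0r addr0 add0r.
exists T, phi; apply: bijective_of.
  move=> [x y] [x' y']; rewrite !phiE /= => eq_z.
  have [xE yE] := vAB x y; have [] := vAB x' y'.
  by rewrite -eq_z xE yE => /vX_inj -> /vY_inj ->.
move=> z; have [x xE] : exists x, vX x = entA 1 *: z.
  by apply/vXE; rewrite scalerA entAA mulr1.
have [y yE] : exists y, vY y = entB 1 *: z.
  by apply/vYE; rewrite scalerA entBB mulr1.
by exists (x, y); rewrite phiE /= xE yE -scalerDl -ent1 scale1r.
Qed.

Definition tmor (T T' : mtuple M N) (a : {linear tup_X T -> tup_X T'})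
    (b : {linear tup_Y T -> tup_Y T'}) : Prop :=
  (forall n y, a (tup_f T (tensor n y)) = tup_f T' (tensor n (b y))) /\
  (forall m x, b (tup_g T (tensor m x)) = tup_g T' (tensor m (a x))).

Lemma tmor_linear T T' (a : {linear tup_X T -> tup_X T'})
    (b : {linear tup_Y T -> tup_Y T'}) :
  tmor a b -> exists phi : {linear tuple_mod T -> tuple_mod T'},
    forall z, phi z = (a z.1, b z.2).
Proof.
move=> [af bg].
have [|phi phiE] := @linear_of Lam (tuple_mod T) (tuple_mod T') (fun z => (a z.1, b z.2)).
  move=> [[a1 n] [m b1]] [x y] [x' y'].
  by congr (_, _); rewrite /= !linearD ?af ?bg linearZ_LR.
by exists phi.
Qed.

(** Commuting with the idempotents [entA 1] and [entB 1] makes [phi] diagonal; commuting with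
    [entN n] and [entM m] is compatibility with the structure maps. *)
Lemma linear_tmor T T' (phi : {linear tuple_mod T -> tuple_mod T'}) :
  exists a b, @tmor T T' a b /\ forall z, phi z = (a z.1, b z.2).
Proof.
have entAE (T0 : mtuple M N) a (x : tup_X T0) (y : tup_Y T0) :
    entA a *: ((x, y) : tuple_mod T0) = (a *: x, 0).
  by congr (_, _); rewrite /= tensor0l linear0 ?scale0r ?addr0.
have entBE (T0 : mtuple M N) b (x : tup_X T0) (y : tup_Y T0) :
    entB b *: ((x, y) : tuple_mod T0) = (0, b *: y).
  by congr (_, _); rewrite /= tensor0l linear0 ?scale0r ?add0r.
have entNE (T0 : mtuple M N) n (x : tup_X T0) (y : tup_Y T0) :
    entN n *: ((x, y) : tuple_mod T0) = (tup_f T0 (tensor n y), 0).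
  by congr (_, _); rewrite /= ?tensor0l ?linear0 ?scale0r ?addr0 ?add0r.
have entME (T0 : mtuple M N) m (x : tup_X T0) (y : tup_Y T0) :
    entM m *: ((x, y) : tuple_mod T0) = (0, tup_g T0 (tensor m x)).
  by congr (_, _); rewrite /= ?tensor0l ?linear0 ?scale0r ?addr0 ?add0r.
have phiA x : phi (x, 0) = ((phi (x, 0)).1, 0).
  rewrite -[in LHS](scale1r x) -(entAE T 1 x 0) linearZ_LR.
  by rewrite [phi _]surjective_pairing entAE scale1r.
have phiB y : phi (0, y) = (0, (phi (0, y)).2).
  rewrite -[in LHS](scale1r y) -(entBE T 1 0 y) linearZ_LR.
  by rewrite [phi _]surjective_pairing entBE scale1r.
have [|a aE] := @linear_of A (tup_X T) (tup_X T') (fun x => (phi (x, 0)).1).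
  move=> c x x'.
  have -> : (c *: x + x', 0) = entA c *: ((x, 0) : tuple_mod T) + (x', 0).
    by rewrite entAE; congr (_, _); rewrite /= addr0.
  rewrite linearP /= [phi (x, 0)]phiA entAE [phi (x', 0)]phiA.
  by [].
have [|b bE] := @linear_of B (tup_Y T) (tup_Y T') (fun y => (phi (0, y)).2).
  move=> c y y'.
  have -> : (0, c *: y + y') = entB c *: ((0, y) : tuple_mod T) + (0, y').
    by rewrite entBE; congr (_, _); rewrite /= addr0.
  rewrite linearP /= [phi (0, y)]phiB entBE [phi (0, y')]phiB.
  by [].
exists a, b; split; first split.
- move=> n y; rewrite aE bE -(entNE T n 0 y) linearZ_LR phiB entNE //.
- move=> m x; rewrite aE bE -(entME T m x 0) linearZ_LR phiA entME //.
- move=> [x y]; rewrite aE bE /=.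
  have -> : (x, y) = (x, 0) + (0, y) :> tuple_mod T.
    by congr (_, _); rewrite /= ?addr0 ?add0r.
  by rewrite linearD phiA phiB; congr (_, _); rewrite /= ?addr0 ?add0r.
Qed.

Lemma tuple_short_exact (T1 T2 T3 : mtuple M N) (a : {linear tup_X T1 -> tup_X T2})
    (b : {linear tup_Y T1 -> tup_Y T2})
    (c : {linear tup_X T2 -> tup_X T3}) (d : {linear tup_Y T2 -> tup_Y T3})
    (phi : {linear tuple_mod T1 -> tuple_mod T2})
    (psi : {linear tuple_mod T2 -> tuple_mod T3}) :
  (forall z, phi z = (a z.1, b z.2)) -> (forall z, psi z = (c z.1, d z.2)) ->
  short_exact phi psi <-> short_exact a c /\ short_exact b d.
Proof.
move=> phiE psiE; split=> [[phi_inj ex psi_surj]|].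
  split; split.
  - move=> x x' ax; suff [] : ((x, 0) : tuple_mod T1) = (x', 0) by [].
    by apply: phi_inj; rewrite !phiE /= ax.
  - move=> x; split=> [cx|[x' <-]].
      have /ex[[x' y']] : psi (x, 0) = 0 by rewrite psiE /= cx linear0.
      by rewrite phiE => -[<- _]; exists x'.
    have /(congr1 fst) : psi (phi (x', 0)) = 0 by apply/ex; exists (x', 0).
    by rewrite psiE phiE.
  - by move=> x; have [[x' y']] := psi_surj (x, 0); rewrite psiE => -[<- _]; exists x'.
  - move=> x x' ax; suff [] : ((0, x) : tuple_mod T1) = (0, x') by [].
    by apply: phi_inj; rewrite !phiE /= ax.
  - move=> x; split=> [cx|[x' <-]].
      have /ex[[y' x']] : psi (0, x) = 0 by rewrite psiE /= cx linear0.
      by rewrite phiE => -[_ <-]; exists x'.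
    have /(congr1 snd) : psi (phi (0, x')) = 0 by apply/ex; exists (0, x').
    by rewrite psiE phiE.
  - by move=> x; have [[y' x']] := psi_surj (0, x); rewrite psiE => -[_ <-]; exists x'.
move=> [[a_inj ac c_surj] [b_inj bd d_surj]]; split.
- move=> [x y] [x' y']; rewrite !phiE /= => -[/a_inj-> /b_inj->] //.
- move=> [x y]; rewrite psiE /=; split=> [[/ac[x' <-] /bd[y' <-]]|].
    by exists (x', y'); rewrite phiE.
  move=> [[x' y']]; rewrite phiE => -[<- <-] /=.
  by rewrite (exact_comp0 _ ac) (exact_comp0 _ bd).
- move=> [x y]; have [x' <-] := c_surj x; have [y' <-] := d_surj y.
  by exists (x', y'); rewrite psiE.
Qed.

Lemma tmor_short_exact (T1 T2 T3 : mtuple M N) (a : {linear tup_X T1 -> tup_X T2})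
    (b : {linear tup_Y T1 -> tup_Y T2})
    (c : {linear tup_X T2 -> tup_X T3}) (d : {linear tup_Y T2 -> tup_Y T3}) :
  tmor a b -> tmor c d -> short_exact a c -> short_exact b d ->
  exists (phi : {linear tuple_mod T1 -> tuple_mod T2})
         (psi : {linear tuple_mod T2 -> tuple_mod T3}), short_exact phi psi.
Proof.
move=> /tmor_linear[phi phiE] /tmor_linear[psi psiE] ac bd.
by exists phi, psi; apply/(tuple_short_exact phiE psiE).
Qed.

Definition swap_tuple (T : mtuple M N) : mtuple N M :=
  MTuple (@tup_gf _ _ _ _ T) (@tup_fg _ _ _ _ T).

Lemma tuple_iso (T T' : mtuple M N) : mod_iso (tuple_mod T) (tuple_mod T') ->
  mod_iso (tup_X T) (tup_X T') /\ mod_iso (tup_Y T) (tup_Y T').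
Proof.
move=> [phi /iso_inverse[psi [phiK psiK]]].
have [a [b [_ abE]]] := linear_tmor phi; have [c [d [_ cdE]]] := linear_tmor psi.
split; [exists a; exists c|exists b; exists d] => z.
- by have := phiK (z, 0); rewrite abE cdE => -[].
- by have := psiK (z, 0); rewrite cdE abE => -[].
- by have := phiK (0, z); rewrite abE cdE => -[].
- by have := psiK (0, z); rewrite cdE abE => -[].
Qed.

(** In components the property of [ext1] is symmetric in A and B, so it can be compared with that of
    the swapped tuples, whose modules live over a different ring. *)
Definition tuple_ext1 (T T' : mtuple M N) : Prop :=
  forall (TK TE : mtuple M N) (a : {linear tup_X TK -> tup_X TE})
    (b : {linear tup_Y TK -> tup_Y TE})
    (c : {linear tup_X TE -> tup_X T}) (d : {linear tup_Y TE -> tup_Y T}),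
  tmor a b -> tmor c d -> short_exact a c -> short_exact b d ->
  forall (u : {linear tup_X TK -> tup_X T'}) (v : {linear tup_Y TK -> tup_Y T'}),
  tmor u v ->
  exists (u' : {linear tup_X TE -> tup_X T'}) (v' : {linear tup_Y TE -> tup_Y T'}),
  [/\ tmor u' v', forall k, u' (a k) = u k & forall k, v' (b k) = v k].

Lemma tuple_ext1P T T' : tuple_ext1 T T' <-> ext1 (tuple_mod T) (tuple_mod T').
Proof.
split=> [TT' K E i p ip f|TT' TK TE a b c d ab cd ac bd u v uv].
  have [TK [phiK phiK_bij]] := tuple_mod_exists K.
  have [TE [phiE phiE_bij]] := tuple_mod_exists E.
  have id_bij : bijective (idfun : {linear tuple_mod T -> tuple_mod T}) by exists id.
  have [i' [p' [ip' i'E p'E]]] := short_exact_iso phiK_bij phiE_bij id_bij ip.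
  have [a [b [ab i'ab]]] := linear_tmor i'; have [c [d [cd p'cd]]] := linear_tmor p'.
  have [u [v [uv fuv]]] := linear_tmor (f \o phiK)%FUN.
  have [ac bd] := proj1 (tuple_short_exact i'ab p'cd) ip'.
  have [u' [v' [/tmor_linear[g gE] u'E v'E]]] := TT' _ _ _ _ _ _ ab cd ac bd _ _ uv.
  have [psi [phiEK psiK]] := iso_inverse phiE_bij.
  have [psi' [_ psi'K]] := iso_inverse phiK_bij.
  exists (g \o psi)%FUN => k /=; rewrite -(psi'K k) -i'E phiEK i'ab gE /= u'E v'E.
  by rewrite -fuv.
have [phi phiE] := tmor_linear ab; have [psi psiE] := tmor_linear cd.
have ses : short_exact phi psi by apply/(tuple_short_exact phiE psiE).
have [f fE] := tmor_linear uv; have [g gE] := TT' _ _ _ _ ses f.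
have [u' [v' [uv' guv]]] := linear_tmor g.
exists u', v'; split=> // k.
  by have := gE (k, 0); rewrite phiE guv fE => -[].
by have := gE (0, k); rewrite phiE guv fE => -[].
Qed.
End Tuples.

Section Swap.
Variables (A B : pzRingType) (M : bimod B A) (N : bimod A B).

Lemma tmor_swap (T T' : mtuple M N) (a : {linear tup_X T -> tup_X T'})
    (b : {linear tup_Y T -> tup_Y T'}) :
  tmor a b <-> @tmor _ _ _ _ (swap_tuple T) (swap_tuple T') b a.
Proof. by split=> -[]; split. Qed.

Lemma ext1_swap (T T' : mtuple M N) :
  ext1 (tuple_mod (swap_tuple T)) (tuple_mod (swap_tuple T')) ->
  ext1 (tuple_mod T) (tuple_mod T').
Proof.
move=> /tuple_ext1P TT'; apply/tuple_ext1P => TK TE a b c d ab cd ac bd u v uv.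
have [|||v' [u' [/tmor_swap uv' v'E u'E]]] :=
  TT' (swap_tuple TK) (swap_tuple TE) b a d c _ _ bd ac v u.
- exact/tmor_swap.
- exact/tmor_swap.
- exact/tmor_swap.
by exists u', v'.
Qed.
End Swap.

(** * The functors T_A and T_B *)

Section FunctorTA.
Variables (A B : pzRingType) (M : bimod B A) (N : bimod A B).
Implicit Types (T : mtuple M N) (L K P : lmodType A).
Local Notation TA := (@functor_TA A B M N).

Lemma tup_f_g T n t : tup_f T (tensor n (tup_g T t)) = 0.
Proof. by have := tup_fg (tensor n t); rewrite tens_mapE. Qed.

Lemma TA_adjoint L T (a : {linear L -> tup_X T}) :
  exists b : {linear tens M L -> tup_Y T},
    tmor (T := TA L) a b /\ forall t, b t = tup_g T (tens_map M a t).
Proof.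
exists (tup_g T \o tens_map M a)%FUN; split=> //; split=> [n y|m x] /=.
  by rewrite linear0 tup_f_g.
by rewrite tens_mapE.
Qed.

Lemma TA_tmor_unique L T (a : {linear L -> tup_X T}) (b : {linear tens M L -> tup_Y T}) :
  tmor (T := TA L) a b -> forall t, b t = tup_g T (tens_map M a t).
Proof.
move=> [_ bg]; apply: (@tens_ext _ _ _ _ _ b (tup_g T \o tens_map M a)%FUN) => m x /=.
by rewrite tens_mapE -bg.
Qed.

Lemma tmor_comp T1 T2 T3 (a : {linear tup_X T1 -> tup_X T2})
    (b : {linear tup_Y T1 -> tup_Y T2})
    (c : {linear tup_X T2 -> tup_X T3}) (d : {linear tup_Y T2 -> tup_Y T3}) :
  tmor a b -> tmor c d -> tmor (c \o a)%FUN (d \o b)%FUN.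
Proof.
move=> [af bg] [cf dg]; split=> [n y|m x] /=; first by rewrite af cf.
by rewrite bg dg.
Qed.

Lemma TA_map K L (u : {linear K -> L}) :
  tmor (T := TA K) (T' := TA L) u (tens_map M u).
Proof. by split=> [n y|m x] /=; [rewrite linear0|rewrite tens_mapE]. Qed.

(** T_A is left adjoint to the first component, which preserves surjections: the A-component of a
    map is lifted through P, and the B-component is then forced by [TA_tmor_unique]. *)
Lemma TA_projective P : projective P -> projective (tuple_mod (TA P)).
Proof.
move=> P_proj V W p f p_surj.
have [TV [phiV /iso_inverse[psiV [_ psiVK]]]] := tuple_mod_exists V.
have [TW [phiW /iso_inverse[psiW [psiWK psiWK']]]] := tuple_mod_exists W.
have [c [d [cd pcd]]] := linear_tmor (psiW \o (p \o phiV))%FUN.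
have [u [v [uv fuv]]] := linear_tmor (psiW \o f)%FUN.
have [|u' u'E] := P_proj _ _ c u.
  move=> x; have [e eE] := p_surj (phiW (x, 0)).
  have := pcd (psiV e); rewrite /= psiVK eE psiWK.
  by move=> -[-> _]; exists (psiV e).1.
have [v' [uv' _]] := TA_adjoint u'.
have [g gE] := tmor_linear uv'.
exists (phiV \o g)%FUN => z; apply: (can_inj psiWK').
rewrite -[psiW (f z)]/((psiW \o f)%FUN z) fuv.
rewrite -[LHS]/((psiW \o (p \o phiV))%FUN (g z)) pcd gE /= u'E; congr (_, _).
rewrite (TA_tmor_unique uv) -[d _]/((d \o v')%FUN z.2) (TA_tmor_unique (tmor_comp uv' cd)).
by congr (tup_g _ _); apply: eq_tens_map => x /=; rewrite u'E.
Qed.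

(** The Tor hypothesis keeps a projective presentation of L exact under T_A, so it becomes a
    projective presentation of T_A L. The adjunction then matches the extension problems for L and
    for T_A L. *)
Lemma ext1_TA L T : Tor_zero 1 M L ->
  ext1 (tuple_mod (TA L)) (tuple_mod T) <-> ext1 L (tup_X T).
Proof.
move=> torL; have [K [P [j [q [P_proj ses]]]]] := presentation_exists L.
have [_ jq q_surj] := ses.
have ses' : short_exact (tens_map M j) (tens_map M q).
  by split; [apply: Tor_zero_inj ses|apply: tens_exact|apply: tens_map_surj].
have [phi phiE] := tmor_linear (TA_map j); have [psi psiE] := tmor_linear (TA_map q).
have Tses : short_exact phi psi by apply/(tuple_short_exact phiE psiE).
split=> LT.
  apply: (ext1_presentation P_proj ses) => f.
  have [b [/tmor_linear[h hE] _]] := TA_adjoint f.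
  have [g gE] := LT _ _ _ _ Tses h.
  have [u [v [_ uvE]]] := linear_tmor g.
  exists u => k; have := gE (k, 0).
  by rewrite phiE uvE hE => -[].
apply: (ext1_presentation (TA_projective P_proj) Tses) => f.
have [u [v [uv fuv]]] := linear_tmor f.
have [u' u'E] := LT _ _ _ _ ses u.
have [v' [uv' _]] := TA_adjoint u'; have [g gE] := tmor_linear uv'.
exists g => z; rewrite phiE gE fuv /= u'E; congr (_, _).
rewrite (TA_tmor_unique uv) (TA_tmor_unique uv'); congr (tup_g _ _).
by rewrite -(@tens_map_comp _ _ _ _ _ _ _ _ u) // => x; rewrite u'E.
Qed.
End FunctorTA.

Section FunctorTB.
Variables (A B : pzRingType) (M : bimod B A) (N : bimod A B).

Lemma swap_tupleK (T : mtuple M N) : swap_tuple (swap_tuple T) = T.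
Proof. by case: T. Qed.

Lemma ext1_swapP (T T' : mtuple M N) :
  ext1 (tuple_mod (swap_tuple T)) (tuple_mod (swap_tuple T')) <->
  ext1 (tuple_mod T) (tuple_mod T').
Proof.
split; first exact: ext1_swap.
by move=> TT'; apply: ext1_swap; rewrite !swap_tupleK.
Qed.

Lemma swap_TB (L : lmodType B) :
  swap_tuple (@functor_TB A B M N L) = @functor_TA B A N M L.
Proof. by congr MTuple; apply: Prop_irrelevance. Qed.

Lemma ext1_TB (L : lmodType B) (T : mtuple M N) : Tor_zero 1 N L ->
  ext1 (tuple_mod (@functor_TB A B M N L)) (tuple_mod T) <-> ext1 L (tup_Y T).
Proof. by move=> torL; rewrite -ext1_swapP swap_TB; apply: ext1_TA. Qed.
End FunctorTB.

(** * Approximations *)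

Section Enlarge.
Variables (A B : pzRingType) (M : bimod B A) (N : bimod A B).
Implicit Types (T : mtuple M N).
Local Notation TA := (@functor_TA A B M N).

(* The Y-component of T' is the pushout of the structure map M ⊗ X -> Y of T
   along M ⊗ X -> M ⊗ X1. *)
Lemma TA_enlarge T (U1 X1 : lmodType A) (i : {linear tup_X T -> X1})
    (q : {linear X1 -> U1}) :
  short_exact i q -> Tor_zero 1 M U1 ->
  exists T' (a : {linear tup_X T -> tup_X T'}) (b : {linear tup_Y T -> tup_Y T'})
    (c : {linear tup_X T' -> U1}) (d : {linear tup_Y T' -> tens M U1}),
  [/\ tup_X T' = X1, tmor a b, tmor (T' := TA U1) c d, short_exact a c &
      short_exact b d].
Proof.
move=> iq torU; have [i_inj i_q q_surj] := iq.
have Miq : short_exact (tens_map M i) (tens_map M q).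
  by split; [apply: Tor_zero_inj iq|apply: tens_exact|apply: tens_map_surj].
have [Y' [g' [b [d [bd g'b dg']]]]] := pushout_extension (tup_g T) Miq.
have [b_inj _ _] := bd.
have [s sE] := linear_copair b g'.
(* Reads off from the two exact rows that Y' is the cokernel of [del]; a map out of N ⊗ Y' is then
   given on N ⊗ (Y + M ⊗ X1). *)
have [s_surj s_ker] : surjective_map s /\
    (forall z, s z = 0 -> exists t, z = (tup_g T t, - tens_map M i t)).
  have [_ b_d _] := bd; have [_ M_iq Mq_surj] := Miq; split=> [y'|[y t]].
    have [t tE] := Mq_surj (d y').
    have /b_d[y yE] : d (y' - g' t) = 0 by rewrite linearB dg' /= tE subrr.
    by exists (y, t); rewrite sE /= yE subrK.
  rewrite sE /= => byt.
  have /M_iq[u uE] : tens_map M q t = 0.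
    by have := congr1 d byt; rewrite linearD linear0 dg' (exact_comp0 _ b_d) add0r.
  exists (- u); rewrite !linearN opprK /= uE; congr (_, _).
  apply: b_inj; rewrite linearN -g'b /= uE; apply/eqP.
  by rewrite -addr_eq0 byt.
have [del delE] := linear_pair (tup_g T) (\- tens_map M i).
have del_s : exact_at del s.
  move=> z; split=> [/s_ker[t ->]|[t <-]]; first by exists t; rewrite delE.
  by rewrite delE sE /= linearN g'b subrr.
have [|pr prE] := @linear_of B (tup_Y T * tens M X1)%type (tup_Y T) (fun z => z.1).
  by move=> x u v.
(* The new structure map is the old one followed by [i] on N ⊗ Y, and zero on the summand N ⊗ (M ⊗
   X1). It descends because f (1 ⊗ g) = 0 in T. *)
have [|f' f'E] := @descend A _ _ _ (tens_map N s)
    (i \o (tup_f T \o tens_map N pr))%FUN (tens_map_surj (M := N) s_surj).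
  move=> _ /(tens_exact (M := N) del_s s_surj)[u <-] /=.
  rewrite -(@tens_map_comp _ _ _ _ _ _ _ _ (tup_g T)) ?tup_fg ?linear0 // => x.
  by rewrite prE delE.
have f'nE n z : f' (tensor n (s z)) = i (tup_f T (tensor n z.1)).
  by rewrite -(tens_mapE s) f'E /= tens_mapE prE.
have f'gE n t : f' (tensor n (g' t)) = 0.
  have -> : g' t = s (0, t) by rewrite sE /= linear0 add0r.
  by rewrite f'nE tensor0r !linear0.
have [||fg gf] := @mtuple_exists A B M N X1 Y' f' g'.
- by move=> n m x; apply: f'gE.
- move=> m n y'; have [z <-] := s_surj y'; rewrite f'nE.
  rewrite -(tens_mapE i) g'b.
  by have := tup_gf (tensor m (tensor n z.1)); rewrite tens_mapE => ->; rewrite linear0.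
exists (MTuple fg gf), i, b, q, d; split=> //=.
- split=> [n y|m x] /=; last by rewrite -g'b /= tens_mapE.
  have -> : b y = s (y, 0) by rewrite sE /= linear0 addr0.
  by rewrite f'nE.
- split=> [n y|m x] /=; last by rewrite dg' /= tens_mapE.
  by have [z <-] := s_surj y; rewrite f'nE (exact_comp0 _ i_q).
Qed.
End Enlarge.

Section EnlargeB.
Variables (A B : pzRingType) (M : bimod B A) (N : bimod A B).

Lemma TB_enlarge (T : mtuple M N) (V1 Y1 : lmodType B)
    (i : {linear tup_Y T -> Y1}) (q : {linear Y1 -> V1}) :
  short_exact i q -> Tor_zero 1 N V1 ->
  exists (T' : mtuple M N) (a : {linear tup_X T -> tup_X T'})
    (b : {linear tup_Y T -> tup_Y T'})
    (c : {linear tup_X T' -> tens N V1}) (d : {linear tup_Y T' -> V1}),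
  [/\ tup_Y T' = Y1, tmor a b, tmor (T' := @functor_TB A B M N V1) c d,
      short_exact a c & short_exact b d].
Proof.
move=> iq torV.
have [T' [b [a [d [c [T'E ba dc bd ac]]]]]] :=
  @TA_enlarge B A N M (swap_tuple T) V1 Y1 i q iq torV.
exists (swap_tuple T'), a, b, c, d; split=> //.
  by case: ba; split.
by case: dc; split.
Qed.
End EnlargeB.

Section Sum.
Variables (A B : pzRingType) (M : bimod B A) (N : bimod A B).
Variables (L : lmodType A) (L' : lmodType B).

(* The tuple of the direct sum of T_A L and T_B L'. *)
Lemma TAB_exists : exists
  (f : {linear tens N (tens M L * L')%type -> (L * tens N L')%type})
  (g : {linear tens M (L * tens N L')%type -> (tens M L * L')%type}),
  [/\ forall n z, f (tensor n z) = (0, tensor n z.2),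
      forall m z, g (tensor m z) = (tensor m z.1, 0),
      forall t : tens N (tens M (L * tens N L')%type), f (tens_map N g t) = 0 &
      forall t : tens M (tens N (tens M L * L')%type), g (tens_map M f t) = 0].
Proof.
have [|s2 s2E] := @linear_of B (tens M L * L')%type L' (fun z => z.2) => //.
have [|s1 s1E] := @linear_of A (L * tens N L')%type L (fun z => z.1) => //.
have [f fE] := linear_pair (\0 : {linear tens N (tens M L * L')%type -> L}) (tens_map N s2).
have [g gE] := linear_pair (tens_map M s1) (\0 : {linear tens M (L * tens N L')%type -> L'}).
have fE' n z : f (tensor n z) = (0, tensor n z.2) by rewrite fE /= tens_mapE s2E.
have gE' m z : g (tensor m z) = (tensor m z.1, 0) by rewrite gE /= tens_mapE s1E.
have [||fg gf] := @mtuple_exists A B M N _ _ f g.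
- by move=> n m x; rewrite gE' fE' /= tensor0r.
- by move=> n m x; rewrite fE' gE' /= tensor0r.
by exists f, g.
Qed.

End Sum.

(** * Tuples with split structure maps, and their decomposition *)

Section Split.
Variables (A B : pzRingType) (M : bimod B A) (N : bimod A B).

(* The structure map of T on N ⊗ Y is a split monomorphism with cokernel L. *)
Definition split_tuple (T : mtuple M N) (L : lmodType A) : Prop :=
  exists (s : {linear L -> tup_X T}) (r : {linear tup_X T -> L}),
  [/\ cancel s r, forall t, r (tup_f T t) = 0,
      forall z, exists t, z = s (r z) + tup_f T t & injective (tup_f T)].

(** The structure map of T is a retract of that of W. Hence its cokernel L' is a retract of L, and
    the section and the injectivity carry over. *)
Lemma split_tuple_retract (T W : mtuple M N) (L : lmodType A)
    (a : {linear tup_X T -> tup_X W}) (b : {linear tup_Y T -> tup_Y W})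
    (c : {linear tup_X W -> tup_X T}) (d : {linear tup_Y W -> tup_Y T}) :
  tmor a b -> tmor c d -> cancel a c -> cancel b d -> split_tuple W L ->
  exists (L' : lmodType A) (u : {linear L' -> L}) (v : {linear L -> L'}),
    cancel u v /\ split_tuple T L'.
Proof.
move=> [af _] [cf _] ac bd [s [r [sr rf srf f_inj]]].
have afE t : a (tup_f T t) = tup_f W (tens_map N b t).
  apply: (@tens_ext _ _ _ _ _ (a \o tup_f T)%FUN (tup_f W \o tens_map N b)%FUN).
  by move=> n y /=; rewrite af tens_mapE.
have cfE t : c (tup_f W t) = tup_f T (tens_map N d t).
  apply: (@tens_ext _ _ _ _ _ (c \o tup_f W)%FUN (tup_f T \o tens_map N d)%FUN).
  by move=> n y /=; rewrite cf tens_mapE.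
have [L' [r' [r'_surj r'f]]] := cokernel_exists (tup_f T).
have [|u uE] := @descend _ _ _ _ r' (r \o a)%FUN r'_surj.
  by move=> _ /r'f[t <-] /=; rewrite afE rf.
(* The elements [a z] and s (r (a z)) differ by a value of [tup_f W], which [c] sends into the image
   of [tup_f T], the kernel of [r']. *)
have vuE z : r' (c (s (r (a z)))) = r' z.
  have [t tE] := srf (a z); rewrite -[z in RHS]ac [in RHS]tE linearD cfE linearD.
  by rewrite [X in _ = _ + X](_ : _ = 0) ?addr0 //; apply/r'f; eexists.
have r'E (z : L') : r' (c (s (u z))) = z.
  by have [x <-] := r'_surj z; rewrite uE /= vuE.
exists L', u, (r' \o (c \o s))%FUN; split=> //.
exists (c \o (s \o u))%FUN, r'; split=> [z|t|z|]; first exact: r'E.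
- by apply/r'f; exists t.
- have /r'f[t tE] : r' (z - c (s (u (r' z)))) = 0 by rewrite linearB r'E subrr.
  by exists t; rewrite tE /= addrC subrK.
- apply: inj_linear0 => t ft.
  have bt : tens_map N b t = 0.
    by apply: f_inj; rewrite -afE ft !linear0.
  rewrite -(@tens_map_id _ _ N _ (d \o b)%FUN bd t).
  by rewrite (@tens_map_comp _ _ _ _ _ _ d b) // bt linear0.
Qed.
End Split.

Section SplitIso.
Variables (A B : pzRingType) (M : bimod B A) (N : bimod A B).

(** The image of [tup_g T] becomes zero in N ⊗ Y, since it comes from N ⊗ (M ⊗ X) = 0; only the
    summand L' of Y survives. *)
Lemma split_tuple_tens (T : mtuple M N) (L' : lmodType B)
    (s : {linear L' -> tup_Y T}) (r : {linear tup_Y T -> L'}) :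
  (forall t : tens N M, t = 0) ->
  (forall z, exists t, z = s (r z) + tup_g T t) ->
  forall t : tens N (tup_Y T), tens_map N s (tens_map N r t) = t.
Proof.
move=> NM0 srg.
apply: (@tens_ext _ _ _ _ _ (tens_map N s \o tens_map N r)%FUN idfun) => n y /=.
rewrite !tens_mapE; have [t tE] := srg y.
rewrite [in RHS]tE tensorDr -[tensor n (tup_g T t)](tens_mapE (tup_g T)).
by rewrite (tens_tens0 NM0 (tensor n t)) linear0 addr0.
Qed.

(** The splitting gives X = L + N ⊗ Y, and N ⊗ Y is identified with N ⊗ L' by [split_tuple_tens]. *)
Lemma split_tuple_component (T : mtuple M N) (L : lmodType A) (L' : lmodType B)
    (s : {linear L -> tup_X T}) (r : {linear tup_X T -> L})
    (s' : {linear L' -> tup_Y T}) (r' : {linear tup_Y T -> L'}) :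
  (forall t : tens N M, t = 0) ->
  cancel s r -> (forall t, r (tup_f T t) = 0) ->
  (forall z, exists t, z = s (r z) + tup_f T t) -> injective (tup_f T) ->
  cancel s' r' -> (forall z, exists t, z = s' (r' z) + tup_g T t) ->
  exists h : {linear (L * tens N L')%type -> tup_X T},
    (forall z, h z = s z.1 + tup_f T (tens_map N s' z.2)) /\ bijective h.
Proof.
move=> NM0 sr rf srf f_inj s'r' srg.
have [h hE] := linear_copair s (tup_f T \o tens_map N s')%FUN.
exists h; split=> //; apply: bijective_of.
  apply: inj_linear0 => -[x t]; rewrite hE /= => xt.
  have x0 : x = 0 by have := congr1 r xt; rewrite linearD linear0 rf sr addr0.
  move: xt; rewrite x0 linear0 add0r -(linear0 (tup_f T)) => /f_inj s't.
  congr (_, _); rewrite -(@tens_map_id _ _ N _ (r' \o s')%FUN s'r' t).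
  by rewrite (@tens_map_comp _ _ _ _ _ _ r' s') // s't linear0.
move=> z; have [t tE] := srf z; exists (r z, tens_map N r' t).
by rewrite hE /= (split_tuple_tens NM0 srg).
Qed.
End SplitIso.

Section SplitSum.
Variables (A B : pzRingType) (M : bimod B A) (N : bimod A B).

(** The isomorphism is the sum of the maps T_A L -> T and T_B L' -> T adjoint to the two sections;
    its components are the bijections of [split_tuple_component] for T and for the swapped tuple. *)
Lemma split_tuple_iso (T : mtuple M N) (L : lmodType A) (L' : lmodType B) :
  (forall t : tens M N, t = 0) -> (forall t : tens N M, t = 0) ->
  split_tuple T L -> split_tuple (swap_tuple T) L' ->
  mod_iso (tuple_mod (@functor_TA A B M N L) * tuple_mod (@functor_TB A B M N L'))%type
    (tuple_mod T).
Proof.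
move=> MN0 NM0 [s [r [sr rf srf f_inj]]] [s' [r' [s'r' r'g srg g_inj]]].
have [h [hE h_bij]] := split_tuple_component NM0 sr rf srf f_inj s'r' srg.
have [h' [h'E h'_bij]] :=
  @split_tuple_component B A N M (swap_tuple T) L' L s' r' s r
    MN0 s'r' r'g srg g_inj sr srf.
have [b [/tmor_linear[phi phiE] bE]] := TA_adjoint s.
have [a [/tmor_swap ab aE]] := @TA_adjoint B A N M L' (swap_tuple T) s'.
have [psi psiE] := @tmor_linear A B M N (functor_TB M N L') T a s' ab.
have [Phi PhiE] := linear_copair phi psi.
exists Phi.
have PhiE' x t y u : Phi ((x, t), (u, y)) = (h (x, u), h' (y, t)).
  rewrite PhiE phiE psiE /= bE aE hE h'E /=; congr (_, _).
  by rewrite addrC.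
have [k hK kK] := h_bij; have [k' h'K k'K] := h'_bij.
exists (fun z => (((k z.1).1, (k' z.2).2), ((k z.1).2, (k' z.2).1))).
  by move=> [[x t] [u y]]; rewrite PhiE' /= hK h'K.
by move=> [x y]; rewrite PhiE' /= -!surjective_pairing kK k'K.
Qed.
End SplitSum.

(** * Precovers by sums of values of T_A and T_B *)

Section Precover.
Variables (A B : pzRingType) (M : bimod B A) (N : bimod A B).

Lemma TAB_iso (L : lmodType A) (L' : lmodType B)
    (f : {linear tens N (tens M L * L')%type -> (L * tens N L')%type})
    (g : {linear tens M (L * tens N L')%type -> (tens M L * L')%type}) fg gf :
  (forall n z, f (tensor n z) = (0, tensor n z.2)) ->
  (forall m z, g (tensor m z) = (tensor m z.1, 0)) ->
  mod_iso (tuple_mod (@MTuple A B M N _ _ f g fg gf))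
    (tuple_mod (@functor_TA A B M N L) * tuple_mod (@functor_TB A B M N L'))%type.
Proof.
move=> fE gE; pose W := @MTuple A B M N _ _ f g fg gf.
pose TA := tuple_mod (@functor_TA A B M N L).
pose TB := tuple_mod (@functor_TB A B M N L').
have [|phi phiE] := @linear_of _ (tuple_mod W) (TA * TB)%type
  (fun z => ((z.1.1, z.2.1), (z.1.2, z.2.2))).
  move=> [[a n] [m b]] [[x t] [u y]] [[x' t'] [u' y']].
  by congr ((_, _), (_, _)); rewrite /= ?fE ?gE /= ?addr0 ?add0r.
exists phi; exists (fun z => ((z.1.1, z.2.1), (z.1.2, z.2.2))).
  by move=> [[x t] [u y]]; rewrite phiE.
by move=> [[x t] [u y]]; rewrite phiE.
Qed.

(** The structure map is [l] after 1 ⊗ q. The latter is injective, since by right exactness its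
    kernel is the image of N ⊗ (M ⊗ L) = 0. *)
Lemma split_tuple_of (T : mtuple M N) (L : lmodType A) (L' : lmodType B)
    (s : {linear L -> tup_X T}) (r : {linear tup_X T -> L})
    (l : {linear tens N L' -> tup_X T})
    (k : {linear tens M L -> tup_Y T}) (q : {linear tup_Y T -> L'}) :
  (forall t : tens N M, t = 0) -> cancel s r -> short_exact l r -> short_exact k q ->
  (forall n y, tup_f T (tensor n y) = l (tensor n (q y))) ->
  split_tuple T L.
Proof.
move=> NM0 sr [l_inj lr r_surj] [_ kq q_surj] fE.
have fE' t : tup_f T t = l (tens_map N q t).
  apply: (@tens_ext _ _ _ _ _ (tup_f T) (l \o tens_map N q)%FUN) => n y /=.
  by rewrite fE tens_mapE.
exists s, r; split=> //.
- by move=> t; rewrite fE' (exact_comp0 _ lr).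
- move=> x; have /lr[t tE] : r (x - s (r x)) = 0 by rewrite linearB sr subrr.
  have [u uE] := tens_map_surj (M := N) q_surj t.
  by exists u; rewrite fE' uE tE addrC subrK.
- apply: inj_linear0 => t; rewrite fE' -(linear0 l) => /l_inj.
  by move=> /(tens_exact (M := N) kq q_surj)[u <-]; rewrite (tens_tens0 NM0 u) linear0.
Qed.
End Precover.

Section PrecoverExists.
Variables (A B : pzRingType) (M : bimod B A) (N : bimod A B).

Lemma precover_exists (T : mtuple M N) (K1 U1 : lmodType A) (K2 V1 : lmodType B)
    (j1 : {linear K1 -> U1}) (p1 : {linear U1 -> tup_X T})
    (j2 : {linear K2 -> V1}) (p2 : {linear V1 -> tup_Y T}) :
  short_exact j1 p1 -> short_exact j2 p2 ->
  exists (W K : mtuple M N) (i : {linear tuple_mod K -> tuple_mod W})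
    (p : {linear tuple_mod W -> tuple_mod T}),
  [/\ short_exact i p,
    mod_iso (tuple_mod W)
      (tuple_mod (@functor_TA A B M N U1) * tuple_mod (@functor_TB A B M N V1))%type,
    exists (u : {linear K1 -> tup_X K}) (v : {linear tup_X K -> tens N V1}),
      short_exact u v,
    exists (u : {linear K2 -> tup_Y K}) (v : {linear tup_Y K -> tens M U1}),
      short_exact u v &
    ((forall t : tens N M, t = 0) -> split_tuple W U1) /\
    ((forall t : tens M N, t = 0) -> split_tuple (swap_tuple W) V1)].
Proof.
move=> ses1 ses2; have [f [g [fE gE fg gf]]] := TAB_exists M N U1 V1.
pose W := @MTuple A B M N _ _ f g fg gf.
(* [c] and [d] are the components of the map T_A U1 + T_B V1 -> T adjoint to [p1] and [p2]. The
   cross terms in the compatibility check are composites of the two structure maps of T, hence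
   zero. *)
have [c cE] := linear_copair p1 (tup_f T \o tens_map N p2)%FUN.
have [d dE] := linear_copair (tup_g T \o tens_map M p1)%FUN p2.
have cd : tmor (T := W) (T' := T) c d.
  split=> [n z|m z] /=.
    by rewrite fE cE dE /= linear0 add0r tens_mapE tensorDr linearD tup_f_g add0r.
  rewrite gE cE dE /= linear0 addr0 tens_mapE tensorDr linearD.
  by rewrite (@tup_f_g _ _ _ _ (swap_tuple T)) addr0.
have [p pE] := tmor_linear cd.
have [K0 [i0 [i0_inj i0p]]] := kernel_exists p.
have p_surj : surjective_map p.
  move=> [x y]; have [_ _ p1_surj] := ses1; have [_ _ p2_surj] := ses2.
  have [u <-] := p1_surj x; have [v <-] := p2_surj y.
  exists ((u, 0), (0, v)); rewrite pE cE dE /= !linear0.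
  by rewrite addr0 add0r.
have [K [phi /[dup] phi_bij /iso_inverse[psi [phiK psiK]]]] := tuple_mod_exists K0.
have ip : short_exact (i0 \o phi)%FUN p.
  split=> //; first by apply: inj_comp => //; apply: bij_inj.
  move=> z; split=> [/i0p[k <-]|[k <-]]; first by exists (psi k); rewrite /= psiK.
  exact: (exact_comp0 _ i0p).
have [a [b [_ iE]]] := linear_tmor (i0 \o phi)%FUN.
have [ac bd] := proj1 (tuple_short_exact iE pE) ip.
exists W, K, (i0 \o phi)%FUN, p; split=> //.
- exact: TAB_iso.
- have [l [r [_ [_ [lr _ [lE _] _]]]]] := short_exact_sum U1 (tens N V1).
  apply: (kernel_extension ses1 ac lr) => u.
  by rewrite lE cE /= !linear0 addr0.
- have [_ [_ [l [r [_ lr [_ lE] _]]]]] := short_exact_sum (tens M U1) V1.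
  apply: (kernel_extension ses2 bd lr) => u.
  by rewrite lE dE /= !linear0 add0r.
- have [l1 [r1 [l2 [r2 [lr1 lr2 [l1E l2E] [r1E r2E]]]]]] :=
    short_exact_sum U1 (tens N V1).
  have [l1' [r1' [l2' [r2' [lr1' lr2' [l1E' l2E'] [r1E' r2E']]]]]] :=
    short_exact_sum (tens M U1) V1.
  split=> [NM0|MN0].
    apply: (@split_tuple_of _ _ _ _ W U1 V1 l1 r2 l2 l1' r1') => // [x|n y].
      by rewrite l1E r2E.
    by rewrite /= fE l2E r1E'.
  apply: (@split_tuple_of _ _ _ _ (swap_tuple W) V1 U1 l2' r1' l1' l2 r2) => // [x|n y].
    by rewrite l2E' r1E'.
  by rewrite /= gE l1E' r2E.
Qed.
End PrecoverExists.

(** * Cotorsion pairs over the Morita ring *)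

Section Main.
Variables (A B : pzRingType) (M : bimod B A) (N : bimod A B).
Variables (U X : mod_class A) (V Y : mod_class B).
Hypotheses (hUX : hereditary_complete_cotorsion_pair U X)
  (hVY : hereditary_complete_cotorsion_pair V Y)
  (hTorM : forall L : lmodType A, U L -> Tor_zero 1 M L)
  (hTorN : forall L : lmodType B, V L -> Tor_zero 1 N L)
  (hMU : forall L : lmodType A, U L -> Y (tens M L))
  (hNV : forall L : lmodType B, V L -> X (tens N L)).

Local Notation D := (tuple_class M N X Y).
Local Notation TA := (@functor_TA A B M N).
Local Notation TB := (@functor_TB A B M N).

Let cotX : cotorsion_pair U X. Proof. by case: hUX. Qed.
Let cotY : cotorsion_pair V Y. Proof. by case: hVY. Qed.

(** [tuple_class] asks only for some isomorphic tuple; the choice is harmless because right classes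
    of cotorsion pairs are closed under retracts, hence under isomorphism. *)
Lemma tuple_classP T : D (tuple_mod T) <-> X (tup_X T) /\ Y (tup_Y T).
Proof.
have [_ Xr] := cotorsion_retract_closed cotX.
have [_ Yr] := cotorsion_retract_closed cotY.
split=> [[T' [XT' YT' /tuple_iso[isoX isoY]]]|[XT YT]]; last first.
  by exists T; split=> //; exists idfun; exists id.
by split; [apply/(retract_closed_iso Xr isoX)|apply/(retract_closed_iso Yr isoY)].
Qed.

Lemma tuple_class_iso Z Z' : mod_iso Z Z' -> D Z -> D Z'.
Proof.
move=> iso [T [XT YT isoT]]; exists T; split=> //; exact: mod_iso_trans iso.
Qed.

Lemma left_perp_TA L : U L -> left_perp D (tuple_mod (TA L)).
Proof.
move=> UL Z [T [XT YT isoT]]; apply/Ext_zero1P.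
apply: (ext1_iso (mod_iso_refl _) isoT); apply/ext1_TA; first exact: hTorM.
by have [_ XP] := cotorsion_ext1 cotX; move/XP: XT; apply.
Qed.

Lemma left_perp_TB L : V L -> left_perp D (tuple_mod (TB L)).
Proof.
move=> UL Z [T [XT YT isoT]]; apply/Ext_zero1P.
apply: (ext1_iso (mod_iso_refl _) isoT); apply/ext1_TB; first exact: hTorN.
by have [_ YP] := cotorsion_ext1 cotY; move/YP: YT; apply.
Qed.

Lemma left_perp_sum L' : TA_plus_TB M N U V L' -> left_perp D L'.
Proof.
move=> [U1 [V1 [UU1 VV1 iso]]]; apply: (left_perp_iso iso).
have [l [r [_ [_ [lr _ _ _]]]]] :=
  short_exact_sum (tuple_mod (TA U1)) (tuple_mod (TB V1)).
by apply: (left_perp_extension lr); [apply: left_perp_TA|apply: left_perp_TB].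
Qed.

Lemma tuple_class_cokernel_closed : cokernel_closed D.
Proof.
have Xc : cokernel_closed X by case: hUX => ? _; apply: hereditary_cokernel_closed.
have Yc : cokernel_closed Y by case: hVY => ? _; apply: hereditary_cokernel_closed.
move=> D1 D2 D3 i p ip DD1 DD2.
have [T1 [f1 f1_bij]] := tuple_mod_exists D1.
have [T2 [f2 f2_bij]] := tuple_mod_exists D2.
have [T3 [f3 f3_bij]] := tuple_mod_exists D3.
have [i' [p' [ip' _ _]]] := short_exact_iso f1_bij f2_bij f3_bij ip.
have [a [b [_ abE]]] := linear_tmor i'; have [c [d [_ cdE]]] := linear_tmor p'.
have [ac bd] := proj1 (tuple_short_exact abE cdE) ip'.
have back (T : mtuple M N) (Z : lmodType (morita M N)) (f : {linear tuple_mod T -> Z}) :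
    bijective f -> D Z -> X (tup_X T) /\ Y (tup_Y T).
  move=> /iso_inverse[g [fK gK]] DZ; apply/tuple_classP.
  by apply: tuple_class_iso DZ; exists g; exists f.
have [X1 Y1] := back _ _ _ f1_bij DD1; have [X2 Y2] := back _ _ _ f2_bij DD2.
apply: (@tuple_class_iso (tuple_mod T3)); first by exists f3.
by apply/tuple_classP; split; [apply: Xc ac _ _|apply: Yc bd _ _].
Qed.

Lemma tuple_class_preenvelope (Z : lmodType (morita M N)) :
  exists (Z' C : lmodType (morita M N)) (i : {linear Z -> Z'}) (p : {linear Z' -> C}),
    [/\ D Z', left_perp D C & short_exact i p].
Proof.
have [T [phi /iso_inverse[psi [phiK psiK]]]] := tuple_mod_exists Z.
have [_ /(_ (tup_X T))[_ [X1 [U1 [i1 [q1 [XX1 UU1 ses1]]]]]] _] := hUX.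
have [T1 [a1 [b1 [c1 [d1 [T1E ab1 cd1 ac1 bd1]]]]]] := TA_enlarge ses1 (hTorM UU1).
have [_ /(_ (tup_Y T1))[_ [Y1 [V1 [i2 [q2 [YY1 VV1 ses2]]]]]] _] := hVY.
have [T2 [a2 [b2 [c2 [d2 [T2E ab2 cd2 ac2 bd2]]]]]] := TB_enlarge ses2 (hTorN VV1).
have [f1 [g1 fg1]] := tmor_short_exact ab1 cd1 ac1 bd1.
have [f2 [g2 fg2]] := tmor_short_exact ab2 cd2 ac2 bd2.
have [C [c [u [v [fc uv]]]]] := short_exact_comp fg1 fg2.
exists (tuple_mod T2), C, (f2 \o f1 \o psi)%FUN, c; split.
(* The second enlargement makes the B-component equal to Y1 but turns the A-component X1 into an
   extension of N ⊗ V1 by X1; [hNV] keeps it in X. *)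
- apply/tuple_classP; split; last by rewrite T2E.
  apply: (cotorsion_extension_closed cotX ac2); first by rewrite T1E.
  exact: hNV.
- by apply: (left_perp_extension uv); [apply: left_perp_TA|apply: left_perp_TB].
- have [f_inj f_c c_surj] := fc; split=> //.
    by apply: inj_comp => //; apply: can_inj psiK.
  move=> z; split=> [/f_c[k <-]|[k <-]]; last exact: (exact_comp0 _ f_c).
  by exists (phi k); rewrite /= phiK.
Qed.

Lemma tuple_class_precover (T : mtuple M N) :
  exists (W : mtuple M N) (K : lmodType (morita M N)) (U1 : lmodType A) (V1 : lmodType B)
    (i : {linear K -> tuple_mod W}) (p : {linear tuple_mod W -> tuple_mod T}),
  [/\ D K, short_exact i p, U U1 /\ V V1,
    mod_iso (tuple_mod W) (tuple_mod (TA U1) * tuple_mod (TB V1))%type &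
    ((forall t : tens N M, t = 0) -> split_tuple W U1) /\
    ((forall t : tens M N, t = 0) -> split_tuple (swap_tuple W) V1)].
Proof.
have [_ /(_ (tup_X T))[[K1 [U1 [j1 [p1 [XK1 UU1 ses1]]]]] _] _] := hUX.
have [_ /(_ (tup_Y T))[[K2 [V1 [j2 [p2 [YK2 VV1 ses2]]]]] _] _] := hVY.
have [W [K [i [p [ip iso [u [v uv]] [u' [v' uv']] spl]]]]] := precover_exists ses1 ses2.
exists W, (tuple_mod K), U1, V1, i, p; split=> //.
apply/tuple_classP; split.
  by apply: (cotorsion_extension_closed cotX uv) => //; apply: hNV.
by apply: (cotorsion_extension_closed cotY uv') => //; apply: hMU.
Qed.

Lemma tuple_class_cotorsion :
  hereditary_complete_cotorsion_pair (left_perp D) D.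
Proof.
split.
- split=> // Z; split=> [DZ L DL|DZ]; first exact: DL.
  have [T [phi phi_bij]] := tuple_mod_exists Z.
  have isoT : mod_iso (tuple_mod T) Z by exists phi.
  have perpT L : left_perp D L -> ext1 L (tuple_mod T).
    move=> DL; apply: (ext1_iso (mod_iso_refl L) (mod_iso_sym isoT)).
    by apply/Ext_zero1P; apply: DZ.
  (* Testing against T_A L and T_B L, which lie in the left orthogonal, already detects membership
     of both components. *)
  apply: (tuple_class_iso isoT); apply/tuple_classP; split.
    have [_ XP] := cotorsion_ext1 cotX; apply/XP => L UL.
    by apply/(@ext1_TA _ _ M N); [apply: hTorM|apply/perpT/left_perp_TA].
  have [_ YP] := cotorsion_ext1 cotY; apply/YP => L VL.
  by apply/(@ext1_TB _ _ M N); [apply: hTorN|apply/perpT/left_perp_TB].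
- move=> Z; split; last first.
    have [Z' [C [i [p [DZ' DC ip]]]]] := tuple_class_preenvelope Z.
    by exists Z', C, i, p.
  have [T [phi phi_bij]] := tuple_mod_exists Z.
  have [W [K [U1 [V1 [i [p [DK ip [UU1 VV1] iso _]]]]]]] := tuple_class_precover T.
  exists K, (tuple_mod W), i, (phi \o p)%FUN; split=> //.
    by apply: left_perp_sum => //; exists U1, V1; split=> //; apply: mod_iso_sym.
  have [i_inj i_p p_surj] := ip; split=> // [w|z].
    by rewrite -i_p /= -(linear0 phi); split=> [/(bij_inj phi_bij)|->].
  have [psi [_ psiK]] := iso_inverse phi_bij; have [w wE] := p_surj (psi z).
  by exists w; rewrite /= wE psiK.
- apply: left_perp_hereditary tuple_class_cokernel_closed _ => Z.
  by have [Z' [C [i [p [DZ' DC [i_inj _ _]]]]]] := tuple_class_preenvelope Z; exists Z', i.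
Qed.

Lemma left_perp_TA_plus_TB (Z : lmodType (morita M N)) :
  (forall t : tens M N, t = 0) -> (forall t : tens N M, t = 0) ->
  left_perp D Z -> TA_plus_TB M N U V Z.
Proof.
move=> MN0 NM0 DZ; have [T [phi phi_bij]] := tuple_mod_exists Z.
have isoT : mod_iso (tuple_mod T) Z by exists phi.
have [W [K [U1 [V1 [i [p [DK ip [UU1 VV1] _ [splW splW']]]]]]]] := tuple_class_precover T.
have /Ext_zero1P TK : Ext_zero 1 (tuple_mod T) K.
  by apply: (left_perp_iso (mod_iso_sym isoT) DZ).
(* Lifting the identity splits the precover, which makes T a retract of W, componentwise. *)
have [s ps] := ext1_lift idfun TK ip.
have [a [b [ab sE]]] := linear_tmor s; have [c [d [cd pE]]] := linear_tmor p.
have ac : cancel a c by move=> x; have := ps (x, 0); rewrite sE pE => -[].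
have bd : cancel b d by move=> y; have := ps (0, y); rewrite sE pE => -[].
have [U2 [u [v [uv splT]]]] := split_tuple_retract ab cd ac bd (splW NM0).
have [V2 [u' [v' [uv' splT']]]] :=
  @split_tuple_retract _ _ _ _ (swap_tuple T) (swap_tuple W) V1 b a d c
    (proj1 (tmor_swap a b) ab) (proj1 (tmor_swap c d) cd) bd ac (splW' MN0).
have [Ur _] := cotorsion_retract_closed cotX.
have [Vr _] := cotorsion_retract_closed cotY.
exists U2, V2; split; [exact: Ur uv UU1|exact: Vr uv' VV1|].
exact: mod_iso_trans (split_tuple_iso MN0 NM0 splT splT') isoT.
Qed.

Lemma TA_plus_TB_cotorsion :
  (forall t : tens M N, t = 0) -> (forall t : tens N M, t = 0) ->
  hereditary_complete_cotorsion_pair (TA_plus_TB M N U V) D.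
Proof.
move=> MN0 NM0; suff -> : TA_plus_TB M N U V = left_perp D.
  exact: tuple_class_cotorsion.
apply: funext => Z; apply: propext; split; first exact: left_perp_sum.
exact: left_perp_TA_plus_TB.
Qed.
End Main.

Theorem theorem4p6 (A B : pzRingType) (M : bimod B A) (N : bimod A B)
    (U X : mod_class A) (V Y : mod_class B)
    (hUX : hereditary_complete_cotorsion_pair U X)
    (hVY : hereditary_complete_cotorsion_pair V Y)
    (hTorM : forall L : lmodType A, U L -> Tor_zero 1 M L)
    (hTorN : forall L : lmodType B, V L -> Tor_zero 1 N L)
    (hMU : forall L : lmodType A, U L -> Y (tens M L))
    (hNV : forall L : lmodType B, V L -> X (tens N L)) :
  (hereditary_complete_cotorsion_pair
     (left_perp (tuple_class M N X Y)) (tuple_class M N X Y))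
  /\
  ((forall t : tens M N, t = 0) -> (forall t : tens N M, t = 0) ->
   hereditary_complete_cotorsion_pair
     (TA_plus_TB M N U V) (tuple_class M N X Y)).
Proof.
split; first exact: (tuple_class_cotorsion hUX hVY hTorM hTorN hMU hNV).
exact: (TA_plus_TB_cotorsion hUX hVY hTorM hTorN hMU hNV).
Qed.
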